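(* Let $d$ be an odd prime, $n\ge1$, and let $G$ be a positive convolution matrix over $\mathbb Z_d$ (invertible with all four entries nonzero). If the $n$-qudit state $\sigma$ is a convex combination of pure stabilizer states, then the quantum convolutional channel $\Lambda_\sigma$ is entanglement-breaking. Consequently, for every quantum channel $\Phi$, $$\chi(\Lambda_\sigma\otimes\Phi)=\chi(\Lambda_\sigma)+\chi(\Phi),\qquad C_H(\Lambda_\sigma)=\chi(\Lambda_\sigma).$$
   Context: All logarithms are base two; all Hilbert spaces are finite-dimensional. $S(\rho)=-\operatorname{tr}\rho\log\rho$ is the von Neumann entropy. Weyl operators. $d$ is an odd prime, $\omega_d=e^{2\pi i/d}$. On one qudit $X|k\rangle=|k+1\rangle$, $Z|k\rangle=\omega_d^k|k\rangle$ (arithmetic mod $d$). $V^n=\mathbb Z_d^n\times\mathbb Z_d^n$; for $p,q\in\mathbb Z_d^n$, $Z^p=\bigotimes_i Z^{p_i}$, $X^q=\bigotimes_i X^{q_i}$, and $w(p,q)=\omega_d^{-2^{-1}p\cdot q}Z^pX^q$ on $(\mathbb C^d)^{\otimes n}$, where $2^{-1}$ is the inverse of $2$ in $\mathbb Z_d$. Symplectic form: $\langle(p,q),(p',q')\rangle_s=p\cdot q'-p'\cdot q$. A maximal isotropic subspace $\mathcal M\subseteq V^n$ is an $n$-dimensional linear subspace on which the form vanishes. A pure stabilizer state is a rank-one projector of the form $P_\mu^{(\mathcal M)}=d^{-n}\sum_{u\in\mathcal M}\mu(u)w(u)$ with $\mathcal M$ maximal isotropic and $\mu\in\operatorname{Hom}(\mathcal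 M,U(1))$ a character. Convolutional channel. $G=\begin{pmatrix} g_{00} & g_{01} \\ g_{10} & g_{11} \end{pmatrix}$ is invertible over $\mathbb Z_d$, $N_G=(\det G)^{-1}\in\mathbb Z_d$, and $U_G$ is the unitary on $\mathcal H_A\otimes\mathcal H_B$, $\mathcal H_A=\mathcal H_B=(\mathbb C^d)^{\otimes n}$, with $U_G|i,j\rangle=|N_Gg_{11}i-N_Gg_{10}j,\,-N_Gg_{01}i+N_Gg_{00}j\rangle$ for $i,j\in\mathbb Z_d^n$. For a state $\sigma$ on $\mathcal H_B$, $\Lambda_\sigma(\rho)=\operatorname{tr}_B[U_G(\rho\otimes\sigma)U_G^\dagger]$. The one-shot Holevo information of a channel $\Lambda$ is $\chi(\Lambda)=\max_{\{p_i,\rho_i\}}\big[S(\Lambda(\sum_ip_i\rho_i))-\sum_ip_iS(\Lambda(\rho_i))\big]$, over finite ensembles of input states, and $C_H(\Lambda)=\lim_{m\to\infty}\frac1m\chi(\Lambda^{\otimes m})$. A channel $\Lambda$ is entanglement-breaking if $(\mathrm{id}\otimes\Lambda)(\omega)$ is separable for every bipartite state $\omega$. *)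

(* Defs.v *)
From HB Require Import structures.
From mathcomp Require Import all_boot all_order all_algebra.
From mathcomp Require Import complex mxtens.
From mathcomp Require Import all_classical all_reals all_analysis.

Set Implicit Arguments.
Unset Strict Implicit.
Unset Printing Implicit Defensive.

Import Order.TTheory GRing.Theory Num.Theory.
Import numFieldNormedType.Exports.

Local Open Scope classical_set_scope.
Local Open Scope ring_scope.
Local Open Scope complex_scope.
Local Open Scope sesquilinear_scope.

(** A Hilbert space of dimension [N] is [C^N], operators are matrices acting on
    columns, [A ^t*] is the adjoint and [A *t B] the Kronecker product; the
    basis vector [|i> (x) |k>] of [C^M (x) C^N] has index
    [mxtens_index (i, k)]. *)

Section States.
Variable R : realType.
Local Notation C := R[i].

(* Over [C], [0 <= z] includes that [z] is real, so [psd A] forces [A] to be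
   Hermitian. *)
Definition psd (N : nat) (A : 'M[C]_N) : Prop :=
  forall v : 'cV[C]_N, 0 <= (v ^t* *m A *m v) 0 0.

Definition is_state (N : nat) (rho : 'M[C]_N) : Prop :=
  psd rho /\ \tr rho = 1.

Definition prob_vector (r : nat) (p : 'I_r -> R) : Prop :=
  (forall k, 0 <= p k) /\ \sum_k p k = 1.

Definition is_separable (M N : nat) (rho : 'M[C]_(M * N)) : Prop :=
  exists r (p : 'I_r -> R) (alpha : 'I_r -> 'M[C]_M) (beta : 'I_r -> 'M[C]_N),
    [/\ prob_vector p,
        forall k, is_state (alpha k),
        forall k, is_state (beta k) &
        rho = \sum_k (p k)%:C *: (alpha k *t beta k)].

Definition ptraceB (M N : nat) (A : 'M[C]_(M * N)) : 'M[C]_M :=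
  \matrix_(i, j) \sum_k A (mxtens_index (i, k)) (mxtens_index (j, k)).

(** Entropy *)

Definition log2 (x : R) : R := ln x / ln 2.

(* [ln x = 0] for [x <= 0], so a zero eigenvalue is sent to [0]; this gives the
   convention [0 log 0 = 0] in [entropy]. *)
Definition logmx (N : nat) (A : 'M[C]_N) : 'M[C]_N :=
  invmx (spectralmx A)
    *m diag_mx (map_mx (fun z : C => (log2 (complex.Re z))%:C) (spectral_diag A))
    *m spectralmx A.

Definition entropy (N : nat) (rho : 'M[C]_N) : R :=
  - complex.Re (\tr (rho *m logmx rho)).

(** Channels *)

(* The tensor product of two linear maps, defined by its values
   [f E_ij (x) g E_kl] on matrix units. *)
Definition tens_map (a b a' b' : nat)
    (f : 'M[C]_a -> 'M[C]_b) (g : 'M[C]_a' -> 'M[C]_b')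
    (X : 'M[C]_(a * a')) : 'M[C]_(b * b') :=
  \sum_i \sum_j \sum_k \sum_l
    X (mxtens_index (i, k)) (mxtens_index (j, l))
      *: (f (delta_mx i j) *t g (delta_mx k l)).

Definition completely_positive (a b : nat) (f : 'M[C]_a -> 'M[C]_b) : Prop :=
  forall (k : nat) (X : 'M[C]_(k * a)),
    psd X -> psd (tens_map (@id 'M[C]_k) f X).

Definition is_channel (a b : nat) (f : 'M[C]_a -> 'M[C]_b) : Prop :=
  [/\ linear f, forall X, \tr (f X) = \tr X & completely_positive f].

Definition entanglement_breaking (a b : nat) (f : 'M[C]_a -> 'M[C]_b) : Prop :=
  is_channel f /\
  forall (k : nat) (X : 'M[C]_(k * a)),
    is_state X -> is_separable (tens_map (@id 'M[C]_k) f X).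

(* [exp_dim a m] is [a ^ m], with [exp_dim a m.+1] convertible to
   [a * exp_dim a m]. *)
Fixpoint exp_dim (a m : nat) : nat :=
  if m is m'.+1 then (a * exp_dim a m')%N else 1%N.

Fixpoint tens_pow (a b : nat) (f : 'M[C]_a -> 'M[C]_b) (m : nat) :
    'M[C]_(exp_dim a m) -> 'M[C]_(exp_dim b m) :=
  match m return 'M[C]_(exp_dim a m) -> 'M[C]_(exp_dim b m) with
  | 0%N => id
  | m'.+1 => tens_map f (@tens_pow a b f m')
  end.
Arguments tens_pow {a b} f m.

(** Holevo information and capacity *)

Definition holevo_quantity (a b : nat) (f : 'M[C]_a -> 'M[C]_b)
    (r : nat) (p : 'I_r -> R) (rho : 'I_r -> 'M[C]_a) : R :=
  entropy (f (\sum_k (p k)%:C *: rho k)) - \sum_k p k * entropy (f (rho k)).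

(* For a channel with nonzero input space, this set of values is nonempty and
   bounded above by [log2 b], and its supremum is a maximum. *)
Definition holevo_chi (a b : nat) (f : 'M[C]_a -> 'M[C]_b) : R :=
  sup [set x : R | exists r (p : 'I_r -> R) (rho : 'I_r -> 'M[C]_a),
    [/\ prob_vector p, forall k, is_state (rho k) &
        x = holevo_quantity f p rho]].

Definition holevo_rate (a b : nat) (f : 'M[C]_a -> 'M[C]_b) (m : nat) : R :=
  m%:R^-1 * holevo_chi (tens_pow f m).

Definition holevo_capacity (a b : nat) (f : 'M[C]_a -> 'M[C]_b) : R :=
  limn (holevo_rate f).

End States.

Section Weyl.
Variables (R : realType) (d n : nat).
Local Notation C := R[i].

(** [Z_d] is ['F_d] ([d] is prime wherever these definitions are used).  The
    computational bases of [C^d] and of its [n]-fold tensor power are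
    indexed by ['F_d] and by [Z_d^n = 'rV['F_d]_n] respectively, through
    [enum_rank]. *)
Definition ket (T : finType) (x : T) : 'cV[C]_#|T| := delta_mx (enum_rank x) 0.

Definition bra (T : finType) (x : T) : 'rV[C]_#|T| := (ket x) ^t*.

Local Notation Zdn := 'rV['F_d]_n.
Local Notation qudit := #|'F_d|.
Local Notation qudits := #|{: 'rV['F_d]_n}|.
Local Notation ket1 := (@ket 'F_d).
Local Notation bra1 := (@bra 'F_d).
Local Notation ketn := (@ket {: 'rV['F_d]_n}).
Local Notation bran := (@bra {: 'rV['F_d]_n}).

Definition omega : C := cos (2 * pi / d%:R) +i* sin (2 * pi / d%:R).

Definition omega_pow (x : 'F_d) : C := omega ^+ (x : nat).

Definition Xop : 'M[C]_qudit := \sum_(k : 'F_d) ket1 (k + 1) *m bra1 k.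

Definition Zop : 'M[C]_qudit :=
  \sum_(k : 'F_d) omega_pow k *: (ket1 k *m bra1 k).

(* [A 0 (x) ... (x) A (n-1)]: its [(x, y)] entry is the product over [i] of the
   [(x_i, y_i)] entries of [A i]. *)
Definition tens_ops (A : 'I_n -> 'M[C]_qudit) : 'M[C]_qudits :=
  \matrix_(r, c) \prod_(i < n)
    A i (enum_rank ((enum_val r : Zdn) 0 i)) (enum_rank ((enum_val c : Zdn) 0 i)).

Definition Zpow (p : Zdn) : 'M[C]_qudits :=
  tens_ops (fun i => Zop ^+ (p 0 i : nat)).

Definition Xpow (q : Zdn) : 'M[C]_qudits :=
  tens_ops (fun i => Xop ^+ (q 0 i : nat)).

Definition dotp (p q : Zdn) : 'F_d := \sum_i p 0 i * q 0 i.

Definition weyl (u : Zdn * Zdn) : 'M[C]_qudits :=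
  omega_pow (- (2^-1 * dotp u.1 u.2)) *: (Zpow u.1 *m Xpow u.2).

Definition symp (u v : Zdn * Zdn) : 'F_d := dotp u.1 v.2 - dotp v.1 u.2.

Definition max_isotropic (M : {vspace Zdn * Zdn}) : Prop :=
  \dim M = n /\ {in M &, forall u v, symp u v = 0}.

(* Only the restriction of [mu] to [M] matters. *)
Definition is_character (M : {vspace Zdn * Zdn}) (mu : Zdn * Zdn -> C) : Prop :=
  {in M &, forall u v, mu (u + v) = mu u * mu v} /\
  {in M, forall u, `|mu u| = 1}.

Definition stab_op (M : {vspace Zdn * Zdn}) (mu : Zdn * Zdn -> C) :
    'M[C]_qudits :=
  (d ^ n)%:R^-1 *: \sum_(u | u \in M) mu u *: weyl u.

Definition rank_one_projector (N : nat) (P : 'M[C]_N) : Prop :=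
  [/\ P ^t* = P, P *m P = P & \rank P = 1%N].

Definition pure_stabilizer_state (P : 'M[C]_qudits) : Prop :=
  rank_one_projector P /\
  exists (M : {vspace Zdn * Zdn}) (mu : Zdn * Zdn -> C),
    [/\ max_isotropic M, is_character M mu & P = stab_op M mu].

Definition stabilizer_mixture (sigma : 'M[C]_qudits) : Prop :=
  exists r (p : 'I_r -> R) (P : 'I_r -> 'M[C]_qudits),
    [/\ prob_vector p, forall k, pure_stabilizer_state (P k) &
        sigma = \sum_k (p k)%:C *: P k].

Definition positive_convolution (G : 'M['F_d]_2) : Prop :=
  G \in unitmx /\ forall i j, G i j != 0.

Definition conv_unitary (G : 'M['F_d]_2) : 'M[C]_(qudits * qudits) :=
  let N := (\det G)^-1 in
  \sum_(i : Zdn) \sum_(j : Zdn)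
    (ketn ((N * G 1 1) *: i - (N * G 1 0) *: j)
       *t ketn (- (N * G 0 1) *: i + (N * G 0 0) *: j))
    *m (bran i *t bran j).

Definition conv_channel (G : 'M['F_d]_2) (sigma rho : 'M[C]_qudits) :
    'M[C]_qudits :=
  ptraceB (conv_unitary G *m (rho *t sigma) *m (conv_unitary G) ^t*).

End Weyl.

(* Main.v *)
Require Import Defs.
From mathcomp Require Import all_boot all_order all_algebra.
From mathcomp Require Import complex mxtens.
From mathcomp Require Import all_classical all_reals all_analysis.
From mathcomp Require Import finfield.
From mathcomp Require Import ring lra.

Set Implicit Arguments.
Unset Strict Implicit.
Unset Printing Implicit Defensive.

Import Order.TTheory GRing.Theory Num.Theory.
Import numFieldNormedType.Exports.

Local Open Scope classical_set_scope.
Local Open Scope complex_scope.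
Local Open Scope ring_scope.
Local Open Scope sesquilinear_scope.

(** Conjugation by the convolution unitary maps Weyl operators to Weyl operators, so
    for a stabilizer state with isotropic subspace [M] and character [mu],
    [Lambda rho = d^-n \sum_(u in M) mu u (tr (w (S u) rho)) w (T u)] with [S], [T]
    diagonal; they are invertible because all entries of [G] are nonzero.
    Expanding [w (S u)] in the joint spectral projectors of the commuting family
    [w (S M)] shows that the channel measures in a stabilizer basis and prepares
    pure stabilizer states.  Mixtures of such channels are again of the form
    [rho |-> \sum_k <e_k|rho|e_k> |psi_k><psi_k|], hence entanglement-breaking.

    Additivity is Shor's argument.  Besides subadditivity of the entropy it needs
    [S (\sum_k q_k psi_k (x) tau_k) >= S (\sum_k q_k psi_k) + \sum_k q_k S (tau_k)].
    As the [psi_k] are pure this follows, by integrating over [s], from the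
    resolvent inequality
    [<psi|(Y_A + s)^-1|psi> <= \sum_j t_j <psi f_j|(Y / t_j + s)^-1|psi f_j>], where
    [tau = \sum_j t_j |f_j><f_j|], which is an instance of Jensen's inequality. *)

(** * Scalar inequalities *)

Section ScalarInequalities.
Variable R : realType.
Implicit Types (I J : finType).

(** For general states the inequality behind Shor's argument is monotonicity of relative entropy,
    which rests on operator convexity. With pure label states [psi] the logarithm of the marginal is
    only needed in the expectation of a single vector, and there the variational bound
    [|a|^2 / y >= 2 Re (conj a * b) - y |b|^2] does the work of operator convexity. Dividing the
    spectrum of [Y] by [t_j] is what produces the entropy of [tau], through
    [ln (x / t_j) = ln x - ln t_j]. Once [entropy_spectral] is available no matrix logarithm
    remains: a trace against a logarithm becomes a sum of diagonal entries in an eigenbasis times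
    scalar logarithms. Because [ln 0 = 0] here, such comparisons carry a support condition: where
    the reference eigenvalue vanishes, the diagonal entry must vanish too. The upper bound on the
    Holevo information splits a joint ensemble in two: the reduced first inputs, and the states to
    which the measurement steers the second input, labelled also by the outcome. Both average to the
    marginals of the same state, so subadditivity handles the average output. *)

Lemma ln_le_subr1 (x : R) : 0 < x -> ln x <= x - 1.
Proof.
move=> x0; have := @le_ln1Dx R (x - 1).
by rewrite (_ : 1 + (x - 1) = x); [apply; rewrite ltrBrDr addNr | ring].
Qed.

Lemma gibbs_term (l y : R) : 0 <= l -> 0 <= y -> (y = 0 -> l = 0) ->
  l * (ln y - ln l) <= y - l.
Proof.
move=> l0 y0 yl; have [->|ln0] := eqVneq l 0; first by rewrite mul0r subr0.
have lp : 0 < l by rewrite lt_def ln0.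
have yp : 0 < y by rewrite lt_def y0 andbT; apply: contra_neq ln0.
rewrite -ln_div //; have /(ler_wpM2l l0) := ln_le_subr1 (divr_gt0 yp lp).
by rewrite mulrBr mulr1 mulrCA divff // mulr1.
Qed.

(** Klein's inequality in scalar form: [D] plays the squared overlaps of two orthonormal bases, [l]
    and [y] the two spectra. Since [D] is doubly stochastic, both sides become double sums weighted
    by [D j i], and [gibbs_term] bounds their difference by [\sum_j y j - \sum_i l i <= 0]. The last
    hypothesis is needed because [ln 0 = 0] would hide an infinite right-hand side. *)
Lemma klein_scalar I J (D : J -> I -> R) (l : I -> R) (y : J -> R) :
  (forall j i, 0 <= D j i) -> (forall j, \sum_i D j i = 1) ->
  (forall i, \sum_j D j i = 1) -> (forall i, 0 <= l i) -> \sum_i l i = 1 ->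
  (forall j, 0 <= y j) -> \sum_j y j <= 1 ->
  (forall j, y j = 0 -> \sum_i D j i * l i = 0) ->
  - \sum_i l i * ln (l i) <= - \sum_j (\sum_i D j i * l i) * ln (y j).
Proof.
move=> D0 Dr Dc l0 l1 y0 y1 yl; rewrite lerN2 -subr_le0.
have -> : \sum_i l i * ln (l i) = \sum_j \sum_i D j i * (l i * ln (l i)).
  by rewrite exchange_big; apply: eq_bigr => i _; rewrite -mulr_suml Dc mul1r.
have -> : \sum_j (\sum_i D j i * l i) * ln (y j) =
          \sum_j \sum_i D j i * (l i * ln (y j)).
  by apply: eq_bigr => j _; rewrite mulr_suml; apply: eq_bigr => i _; rewrite mulrA.
rewrite -sumrB; under eq_bigr do rewrite -sumrB.
apply: (@le_trans _ _ (\sum_j \sum_i D j i * (y j - l i))); last first.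
  have -> : \sum_j \sum_i D j i * (y j - l i) = \sum_j y j - \sum_i l i.
    rewrite [X in _ = _ - X](_ : _ = \sum_j \sum_i D j i * l i); last first.
      rewrite exchange_big; apply: eq_bigr => i _.
      by rewrite -mulr_suml Dc mul1r.
    rewrite -sumrB; apply: eq_bigr => j _.
    rewrite -[y j in RHS]mul1r -(Dr j) mulr_suml -sumrB.
    by apply: eq_bigr => i _; rewrite mulrBr.
  by rewrite l1 subr_le0.
apply: ler_sum => j _; apply: ler_sum => i _.
have [->|Dn] := eqVneq (D j i) 0; first by rewrite !mul0r subrr.
rewrite -!mulrBr ler_wpM2l // gibbs_term // => yj0.
have /eqP := yl _ yj0; rewrite psumr_eq0; last by move=> ? _; rewrite mulr_ge0.
by move=> /allP/(_ i); rewrite mem_index_enum mulf_eq0 (negPf Dn) => /(_ isT)/eqP.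
Qed.

Lemma le0_linear_small (a K : R) : (forall s, 0 < s -> a <= K * s) -> a <= 0.
Proof.
move=> aK; rewrite leNgt; apply/negP => a0.
have K0 : 0 < `|K| + 1 by rewrite ltr_wpDl.
have := aK (a / (2 * (`|K| + 1))); rewrite divr_gt0 ?mulr_gt0 // => /(_ isT).
have : K * (a / (2 * (`|K| + 1))) <= (`|K| + 1) * (a / (2 * (`|K| + 1))).
  rewrite ler_wpM2r ?divr_ge0 ?(ltW a0) ?mulr_ge0 ?(ltW K0) //.
  by rewrite (le_trans (ler_norm _)) // lerDl.
have -> : (`|K| + 1) * (a / (2 * (`|K| + 1))) = a / 2.
  by field; rewrite gt_eqF.
by move=> h1 h2; have := le_trans h2 h1; move: a0; lra.
Qed.

Lemma ln_shift (x s : R) : 0 <= x -> 0 < s -> ln (x + s) <= ln s + x / s.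
Proof.
move=> x0 s0; have -> : x + s = s * (1 + x / s) by field; rewrite gt_eqF.
have xs : 0 <= x / s by rewrite divr_ge0 // ltW.
by rewrite lnM ?posrE ?ltr_wpDr // lerD2l le_ln1Dx // (lt_le_trans _ xs) // ltrN10.
Qed.

(* The hypothesis on the resolvents says that
   [h s = \sum_i c i * ln (x i + s) - \sum_j c' j * ln (x' j + s)] is
   nondecreasing; as [h] vanishes at infinity, [h 0 <= 0]. *)
Lemma le_sum_ln_of_resolvent I J (c x : I -> R) (c' x' : J -> R) :
  (forall i, 0 <= c i) -> (forall i, 0 <= x i) -> (forall i, x i = 0 -> c i = 0) ->
  (forall j, 0 <= c' j) -> (forall j, 0 <= x' j) ->
  (forall j, x' j = 0 -> c' j = 0) ->
  \sum_i c i = \sum_j c' j ->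
  (forall s : R, 0 < s -> \sum_j c' j / (x' j + s) <= \sum_i c i / (x i + s)) ->
  \sum_i c i * ln (x i) <= \sum_j c' j * ln (x' j).
Proof.
move=> c0 x0 cx c0' x0' cx' cc hres.
pose h s := \sum_i c i * ln (x i + s) - \sum_j c' j * ln (x' j + s).
pose dh s := \sum_i c i / (x i + s) - \sum_j c' j / (x' j + s).
have dln (y s : R) : 0 <= y -> 0 < s ->
    is_derive s 1 (fun t => ln (y + t)) (y + s)^-1.
  move=> y0 s0; have ys : 0 < y + s by rewrite ltr_wpDl.
  have dl := is_derive1_ln ys.
  have ds : is_derive s 1 (fun t : R => y + t) 1.
    by have := is_deriveD (is_derive_cst y s 1) (is_derive_id s 1); rewrite add0r.
  by have := @is_derive1_comp _ _ _ s _ _ dl ds; rewrite mulr1.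
have dsum (K : finType) (e z : K -> R) (s : R) : (forall k, 0 <= z k) -> 0 < s ->
    is_derive s 1 (fun t => \sum_k e k * ln (z k + t)) (\sum_k e k / (z k + s)).
  move=> z0 s0.
  have -> : (fun t => \sum_k e k * ln (z k + t)) =
            \sum_k (e k \*: (fun t => ln (z k + t))).
    by apply/funext => t; rewrite fct_sumE.
  elim/big_ind2 : _ => [|f df g dg hf hg|k _]; first exact: is_derive_cst.
    exact: is_deriveD.
  exact/is_deriveZ/dln.
have dhP (s : R) : 0 < s -> is_derive s 1 h (dh s).
  by move=> s0; apply: is_deriveB; apply: dsum.
have hmono (s s' : R) : 0 < s -> s <= s' -> h s <= h s'.
  move=> s0 ss'; rewrite -subr_ge0.
  have [||u uin ->] := @MVT_segment R h dh s s' ss'.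
  - move=> u; rewrite in_itv /= => /andP[su _]; apply: dhP; exact: lt_trans su.
  - apply: derivable_within_continuous => u; rewrite in_itv /= => /andP[su _].
    by have [] := dhP u (lt_le_trans s0 su).
  - rewrite mulr_ge0 ?subr_ge0 // hres //.
    by move: uin; rewrite in_itv /= => /andP[su _]; exact: lt_le_trans su.
(* As [ln (x' j + s) >= ln s] and the total weights agree, the terms in [ln s] cancel and only the
   error of [ln_shift] is left. *)
have h_le (s : R) : 0 < s -> h s <= (\sum_i c i * x i) / s.
  move=> s0; rewrite /h lerBlDr.
  apply: (@le_trans _ _ (\sum_i c i * (ln s + x i / s))).
    by apply: ler_sum => i _; rewrite ler_wpM2l // ln_shift.
  under eq_bigr do rewrite mulrDr mulrA.
  rewrite big_split /= -!mulr_suml addrC lerD2l cc mulr_suml.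
  apply: ler_sum => j _; rewrite ler_wpM2l // ler_ln ?posrE ?lerDr //.
  by rewrite ltr_wpDl.
have h_le0 (s : R) : 0 < s -> h s <= 0.
  move=> s0; apply: (@le0_linear_small _ (\sum_i c i * x i)) => e e0.
  (* Below [e^-1] monotonicity moves [s] up to [e^-1]; above it, [h_le] at [s] itself is already
     small enough. *)
  have [es|es] := leP s e^-1.
    by have := h_le _ (lt_le_trans s0 es); rewrite invrK; apply: le_trans; exact: hmono.
  apply: (le_trans (h_le _ s0)); rewrite ler_wpM2l //.
    by apply: sumr_ge0 => i _; rewrite mulr_ge0.
  by rewrite -[leRHS]invrK lef_pV2 ?posrE ?invr_gt0 // ltW.
rewrite -subr_le0.
(* The limit [s -> 0]: the left sum only grows when [s] is added, and on the right [ln_shift], with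
   the shift now [x' j], costs at most [s / x' j]. Indices with a zero argument carry zero
   weight. *)
apply: (@le0_linear_small _ (\sum_j c' j * (x' j)^-1)) => s s0.
rewrite lerBlDr; apply: (@le_trans _ _ (\sum_i c i * ln (x i + s))).
  apply: ler_sum => i _; have [xi0|xi0] := eqVneq (x i) 0.
    by rewrite cx // !mul0r.
  have xip : 0 < x i by rewrite lt_def xi0 x0.
  by rewrite ler_wpM2l // ler_ln ?posrE ?lerDl ?ltW // ltr_wpDr // ltW.
have := h_le0 _ s0; rewrite /h subr_le0 => /le_trans; apply.
rewrite mulr_suml -big_split /=; apply: ler_sum => j _.
have [xj0|xj0] := eqVneq (x' j) 0; first by rewrite cx' // !mul0r addr0.
have xjp : 0 < x' j by rewrite lt_def xj0 x0'.
rewrite -mulrA -mulrDr ler_wpM2l // addrC [_^-1 * _]mulrC.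
by rewrite [_ / _ + _]addrC ln_shift // ltW.
Qed.

End ScalarInequalities.

(** * Spectral decompositions *)

Section Adjoint.
Variable R : realType.
Local Notation C := R[i].

Lemma adjE m n (A : 'M[C]_(m, n)) i j : A ^t* i j = (A j i)^*.
Proof. by rewrite !mxE. Qed.

Lemma adjM m n p (A : 'M[C]_(m, n)) (B : 'M[C]_(n, p)) :
  (A *m B) ^t* = B ^t* *m A ^t*.
Proof. by rewrite trmx_mul map_mxM. Qed.

Lemma adjD m n (A B : 'M[C]_(m, n)) : (A + B) ^t* = A ^t* + B ^t*.
Proof. by apply/matrixP => i j; rewrite !mxE rmorphD. Qed.

Lemma adjB m n (A B : 'M[C]_(m, n)) : (A - B) ^t* = A ^t* - B ^t*.
Proof. by apply/matrixP => i j; rewrite !mxE rmorphB. Qed.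

Lemma adjZ m n (a : C) (A : 'M[C]_(m, n)) : (a *: A) ^t* = a^* *: A ^t*.
Proof. by apply/matrixP => i j; rewrite !mxE rmorphM. Qed.

Lemma adj_tens m n p q (A : 'M[C]_(m, n)) (B : 'M[C]_(p, q)) :
  (A *t B) ^t* = A ^t* *t B ^t*.
Proof. by rewrite trmx_tens map_mxT. Qed.

Lemma conj_real (x : R) : (x%:C)^* = x%:C :> C.
Proof. exact: conjc_real. Qed.

Definition sqn (z : C) : R := (complex.Re z) ^+ 2 + (complex.Im z) ^+ 2.

Lemma sqn_ge0 z : 0 <= sqn z.
Proof. by rewrite addr_ge0 ?sqr_ge0. Qed.

Lemma sqnE (z : C) : (sqn z)%:C = z * z^*.
Proof. by rewrite /sqn add_Re2_Im2 normCK. Qed.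

Lemma sqnM (x y : C) : sqn (x * y) = sqn x * sqn y.
Proof. by apply: complexI; rewrite rmorphM /= !sqnE rmorphM mulrACA. Qed.

Lemma sqn_real (x : R) : sqn x%:C = x ^+ 2.
Proof. by rewrite /sqn /= expr0n addr0. Qed.

Lemma Re_sum (I : Type) (r : seq I) (P : pred I) (F : I -> C) :
  complex.Re (\sum_(i <- r | P i) F i) = \sum_(i <- r | P i) complex.Re (F i).
Proof.
have ReD : {morph @complex.Re R : x y / x + y} by move=> [? ?] [? ?].
exact: (big_morph _ ReD).
Qed.

Lemma ReZ (x : R) (z : C) : complex.Re (x%:C * z) = x * complex.Re z.
Proof. by case: z => a b /=; rewrite mul0r subr0. Qed.

Lemma real_sum (I : Type) (r : seq I) (P : pred I) (F : I -> R) :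
  (\sum_(i <- r | P i) F i)%:C = \sum_(i <- r | P i) (F i)%:C :> C.
Proof. exact: rmorph_sum. Qed.

Lemma ge0_Re (z : C) : 0 <= z -> z = (complex.Re z)%:C.
Proof. by case: z => a b; rewrite lecE /= => /andP[/eqP ->]. Qed.

Lemma form_norm N (v : 'cV[C]_N) :
  (v ^t* *m v) 0 0 = (\sum_i sqn (v i 0))%:C.
Proof.
rewrite mxE real_sum; apply: eq_bigr => i _.
by rewrite adjE sqnE mulrC.
Qed.

Lemma unitary_row_sqn N (X : 'M[C]_N) j :
  X \is unitarymx -> \sum_i sqn (X j i) = 1.
Proof.
move=> /unitarymxP/matrixP/(_ j j); rewrite !mxE eqxx => h.
apply: complexI; rewrite real_sum -[RHS]h; apply: eq_bigr => i _.
by rewrite adjE sqnE.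
Qed.

Lemma unitary_col_sqn N (X : 'M[C]_N) i :
  X \is unitarymx -> \sum_j sqn (X j i) = 1.
Proof.
rewrite -trmxC_unitary => /(unitary_row_sqn i) <-; apply: eq_bigr => j _.
by apply: complexI; rewrite !sqnE adjE conjCK mulrC.
Qed.

Lemma unitary_adj_mul N (X : 'M[C]_N) : X \is unitarymx -> X ^t* *m X = 1%:M.
Proof. by rewrite -trmxC_unitary => /unitarymxP; rewrite trmxCK. Qed.

End Adjoint.

(** * Positive semidefinite matrices and their eigendecompositions *)

Section Spectral.
Variable R : realType.
Local Notation C := R[i].

Lemma psd_congr M N (A : 'M[C]_M) (B : 'M[C]_(M, N)) :
  psd A -> psd (B ^t* *m A *m B).
Proof. by move=> Apsd v; rewrite !mulmxA -adjM -mulmxA. Qed.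

Lemma psd_diag N (A : 'M[C]_N) i : psd A -> 0 <= A i i.
Proof.
by move=> /(_ (delta_mx i 0)); rewrite trmx_delta map_delta_mx -rowE -colE !mxE.
Qed.

(** Polarization: the form of [A - A ^t*] vanishes because that of [A] is real, and its values at
    [e_i + z e_j] for [z = 1] and [z = 'i] force each entry to be zero. *)
Lemma psd_herm N (A : 'M[C]_N) : psd A -> A ^t* = A.
Proof.
move=> Apsd; apply/eqP; rewrite eq_sym -subr_eq0; apply/eqP.
set B := A - _.
have Bform (v : 'cV[C]_N) : (v ^t* *m B *m v) 0 0 = 0.
  rewrite mulmxBr mulmxBl.
  have -> : v ^t* *m A ^t* *m v = (v ^t* *m A *m v) ^t*.
    by rewrite !adjM trmxCK mulmxA.
  rewrite mxE [X in _ + X]mxE adjE [X in X^*]ge0_Re ?Apsd // conj_real.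
  by rewrite -ge0_Re ?Apsd // subrr.
have Bz i j (z : C) : B i i + z * B i j + z^* * B j i + z * z^* * B j j = 0.
  rewrite -[RHS](Bform (delta_mx i 0 + z *: delta_mx j 0)).
  rewrite adjD adjZ mulmxDr -scalemxAr !mulmxDl -!scalemxAl.
  rewrite !(trmx_delta, map_delta_mx) -!rowE -!colE !mxE; ring.
have B0 i : B i i = 0 by have := Bz i i 0; rewrite rmorph0 !mul0r !addr0.
apply/matrixP => i j; rewrite [RHS]mxE.
have := Bz i j 1; have := Bz i j 'i.
rewrite conjCi rmorph1 !B0 !mul1r !mulr0 !addr0 !add0r mulNr.
move=> /eqP; rewrite subr_eq0 => /eqP/(mulfI (neq0Ci _)) <- /eqP.
by rewrite -mulr2n mulrn_eq0 => /eqP.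
Qed.

(** A relation rather than the canonical [spectralmx], so that product bases [W *t V] also qualify.
    The eigenvectors are the columns of [W ^t*]. *)
Definition eigdec N (W : 'M[C]_N) (l : 'I_N -> R) (A : 'M[C]_N) : Prop :=
  [/\ W \is unitarymx, forall i, 0 <= l i &
      A = W ^t* *m diag_mx (\row_i (l i)%:C) *m W].

Lemma eigdec_form N W l (A : 'M[C]_N) (v : 'cV[C]_N) : eigdec W l A ->
  (v ^t* *m A *m v) 0 0 = (\sum_i l i * sqn ((W *m v) i 0))%:C.
Proof.
case=> _ _ ->; rewrite !mulmxA -adjM -mulmxA mxE real_sum.
set u := W *m v; apply: eq_bigr => i _.
by rewrite mul_mx_diag mxE adjE [X in _ * X * _]mxE rmorphM /= sqnE; ring.
Qed.

(** For unitary [V] the coefficients are the squared overlaps of two orthonormal bases, that is, the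
    matrix [D] of [klein_scalar]. *)
Lemma eigdec_diag N W l (A V : 'M[C]_N) j : eigdec W l A ->
  (V *m A *m V ^t*) j j = (\sum_i sqn ((V *m W ^t*) j i) * l i)%:C.
Proof.
case=> _ _ ->; rewrite -!mulmxA (mulmxA V) -{2}[W]trmxCK -adjM mulmxA.
set X := V *m _; rewrite mxE real_sum; apply: eq_bigr => i _.
by rewrite mul_mx_diag mxE adjE [Y in _ * Y * _]mxE rmorphM /= sqnE; ring.
Qed.

Lemma eigdec_psd N W l (A : 'M[C]_N) : eigdec W l A -> psd A.
Proof.
move=> h v; rewrite (eigdec_form _ h) ler0c; case: h => _ l0 _.
by apply: sumr_ge0 => i _; rewrite mulr_ge0 ?sqn_ge0.
Qed.

Lemma eigdec_tr N W l (A : 'M[C]_N) : eigdec W l A -> \tr A = (\sum_i l i)%:C.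
Proof.
case=> Wu _ ->; rewrite mxtrace_mulC mulmxA (unitarymxP Wu) mul1mx.
by rewrite mxtrace_diag real_sum; apply: eq_bigr => i _; rewrite mxE.
Qed.

Lemma eigdec_eigen N W l (A : 'M[C]_N) i : eigdec W l A ->
  (W *m A *m W ^t*) i i = (l i)%:C.
Proof.
case=> Wu _ ->; rewrite !mulmxA (unitarymxP Wu) mul1mx -mulmxA.
by rewrite (unitarymxP Wu) mulmx1 !mxE eqxx.
Qed.

Lemma psd_spectral N (A : 'M[C]_N) : psd A ->
  eigdec (spectralmx A) (fun i => complex.Re (spectral_diag A 0 i)) A.
Proof.
move=> Apsd; have An : A \is normalmx by apply/normalmxP; rewrite psd_herm.
have Wu := spectral_unitarymx A.
have := orthomx_spectralP An; rewrite invmx_unitary // => AE.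
have sd i : 0 <= spectral_diag A 0 i.
  have := psd_diag i (psd_congr ((spectralmx A) ^t*) Apsd).
  rewrite trmxCK {2}AE !mulmxA (unitarymxP Wu) mul1mx -mulmxA.
  by rewrite (unitarymxP Wu) mulmx1 !mxE eqxx.
split => //.
  by move=> i; rewrite -ler0c -ge0_Re.
rewrite {1}AE; congr (_ *m diag_mx _ *m _); apply/rowP => i.
by rewrite mxE -ge0_Re.
Qed.

End Spectral.

(** * Tensor products and partial traces *)

Section Slots.
Variable R : realType.
Local Notation C := R[i].

Lemma sum_mxtens (V : nmodType) M N (F : 'I_(M * N) -> V) :
  \sum_r F r = \sum_i \sum_k F (mxtens_index (i, k)).
Proof.
rewrite pair_big /= (reindex (@mxtens_index M N)) /=.
  by apply: eq_bigr => [[i k]].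
by exists (@mxtens_unindex M N) => r _; rewrite ?mxtens_indexK ?mxtens_unindexK.
Qed.

Lemma matrix_tensP M N M' N' (A B : 'M[C]_(M * N, M' * N')) :
  (forall i k j l, A (mxtens_index (i, k)) (mxtens_index (j, l)) =
                   B (mxtens_index (i, k)) (mxtens_index (j, l))) -> A = B.
Proof.
move=> AB; apply/matrixP => r s.
by rewrite -[r]mxtens_unindexK -[s]mxtens_unindexK; case: (mxtens_unindex r);
  case: (mxtens_unindex s).
Qed.

Definition tensv M N (v : 'cV[C]_M) (w : 'cV[C]_N) : 'cV[C]_(M * N) :=
  \col_r (v (mxtens_unindex r).1 0 * w (mxtens_unindex r).2 0).

(* [slotA N b] and [slotB M b] are [b (x) 1] and [1 (x) b]; they are not defined
   with [*t] because [1 * N] is not convertible to [N]. *)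
Definition slotA M N (b : 'cV[C]_M) : 'M[C]_(M * N, N) :=
  \matrix_(r, k) (b (mxtens_unindex r).1 0 * ((mxtens_unindex r).2 == k)%:R).

Definition slotB M N (b : 'cV[C]_N) : 'M[C]_(M * N, M) :=
  \matrix_(r, k) (((mxtens_unindex r).1 == k)%:R * b (mxtens_unindex r).2 0).

Lemma slotAE M N (b : 'cV[C]_M) i k l :
  slotA N b (mxtens_index (i, k)) l = b i 0 * (k == l)%:R.
Proof. by rewrite mxE mxtens_indexK. Qed.

Lemma slotBE M N (b : 'cV[C]_N) i k l :
  slotB M b (mxtens_index (i, k)) l = (i == l)%:R * b k 0.
Proof. by rewrite mxE mxtens_indexK. Qed.

Lemma tensvE M N (v : 'cV[C]_M) (w : 'cV[C]_N) i k :
  tensv v w (mxtens_index (i, k)) 0 = v i 0 * w k 0.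
Proof. by rewrite mxE mxtens_indexK. Qed.

Lemma sum_delta (I : finType) (F : I -> C) k :
  \sum_i F i * (i == k)%:R = F k.
Proof.
rewrite (bigD1 k) //= eqxx mulr1 big1 ?addr0 // => i /negPf ->.
by rewrite mulr0.
Qed.

Lemma slotA_mulv M N (b : 'cV[C]_M) (w : 'cV[C]_N) : slotA N b *m w = tensv b w.
Proof.
apply/colP => r; rewrite -[r]mxtens_unindexK; case: (mxtens_unindex r) => i k.
rewrite tensvE mxE -(sum_delta (fun l => b i 0 * w l 0) k).
by apply: eq_bigr => l _; rewrite slotAE eq_sym mulrAC.
Qed.

Lemma slotB_mulv M N (v : 'cV[C]_M) (b : 'cV[C]_N) : slotB M b *m v = tensv v b.
Proof.
apply/colP => r; rewrite -[r]mxtens_unindexK; case: (mxtens_unindex r) => i k.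
rewrite tensvE mxE -(sum_delta (fun l => v l 0 * b k 0) i).
by apply: eq_bigr => l _; rewrite slotBE eq_sym; ring.
Qed.

Lemma slotA_congrE M N (b : 'cV[C]_M) (X : 'M[C]_(M * N)) k l :
  (slotA N b ^t* *m X *m slotA N b) k l =
  \sum_i \sum_j (b i 0)^* * X (mxtens_index (i, k)) (mxtens_index (j, l)) * b j 0.
Proof.
rewrite -mulmxA mxE sum_mxtens; apply: eq_bigr => i _.
under eq_bigr do rewrite adjE slotAE rmorphM rmorph_nat mulrAC.
rewrite sum_delta mxE sum_mxtens mulr_sumr; apply: eq_bigr => j _.
under eq_bigr do rewrite slotAE mulrA.
by rewrite sum_delta mulrA.
Qed.

Lemma slotB_congrE M N (b : 'cV[C]_N) (X : 'M[C]_(M * N)) i j :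
  (slotB M b ^t* *m X *m slotB M b) i j =
  \sum_k \sum_l (b k 0)^* * X (mxtens_index (i, k)) (mxtens_index (j, l)) * b l 0.
Proof.
rewrite -mulmxA mxE sum_mxtens exchange_big; apply: eq_bigr => k _ /=.
under eq_bigr do rewrite adjE slotBE rmorphM rmorph_nat -mulrA mulrC.
rewrite sum_delta mxE sum_mxtens exchange_big mulr_sumr; apply: eq_bigr => l _ /=.
under eq_bigr do rewrite slotBE mulrCA mulrC.
by rewrite sum_delta mulrA.
Qed.

Definition ptraceA M N (X : 'M[C]_(M * N)) : 'M[C]_N :=
  \matrix_(k, l) \sum_i X (mxtens_index (i, k)) (mxtens_index (i, l)).

Lemma ptraceB_slot M N (X : 'M[C]_(M * N)) :
  ptraceB X = \sum_k slotB M (delta_mx k 0) ^t* *m X *m slotB M (delta_mx k 0).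
Proof.
apply/matrixP => i j; rewrite mxE summxE; apply: eq_bigr => k _.
rewrite slotB_congrE -[LHS](sum_delta (fun k' =>
  X (mxtens_index (i, k')) (mxtens_index (j, k))) k).
apply: eq_bigr => k' _.
rewrite -[LHS](sum_delta (fun l =>
  X (mxtens_index (i, k')) (mxtens_index (j, l)) * (k' == k)%:R) k).
by apply: eq_bigr => l _; rewrite !mxE !andbT rmorph_nat; ring.
Qed.

Lemma ptraceA_slot M N (X : 'M[C]_(M * N)) :
  ptraceA X = \sum_i slotA N (delta_mx i 0) ^t* *m X *m slotA N (delta_mx i 0).
Proof.
apply/matrixP => k l; rewrite mxE summxE; apply: eq_bigr => i _.
rewrite slotA_congrE -[LHS](sum_delta (fun i' =>
  X (mxtens_index (i', k)) (mxtens_index (i, l))) i).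
apply: eq_bigr => i' _.
rewrite -[LHS](sum_delta (fun j =>
  X (mxtens_index (i', k)) (mxtens_index (j, l)) * (i' == i)%:R) i).
by apply: eq_bigr => j _; rewrite !mxE !andbT rmorph_nat; ring.
Qed.

Lemma psd_sum (I : finType) N (F : I -> 'M[C]_N) :
  (forall i, psd (F i)) -> psd (\sum_i F i).
Proof.
move=> Fpsd v; rewrite mulmx_sumr mulmx_suml summxE.
by apply: sumr_ge0 => i _; exact: Fpsd.
Qed.

Lemma psdZ N (a : R) (A : 'M[C]_N) : 0 <= a -> psd A -> psd (a%:C *: A).
Proof. by move=> a0 Apsd v; rewrite -scalemxAr -scalemxAl mxE mulr_ge0 ?ler0c. Qed.

Lemma psd_tr_ge0 N (A : 'M[C]_N) : psd A -> 0 <= \tr A.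
Proof. by move=> Apsd; apply: sumr_ge0 => i _; exact: psd_diag. Qed.

Lemma psd_ptraceB M N (X : 'M[C]_(M * N)) : psd X -> psd (ptraceB X).
Proof.
by move=> Xpsd; rewrite ptraceB_slot; apply: psd_sum => k; exact: psd_congr.
Qed.

Lemma psd_ptraceA M N (X : 'M[C]_(M * N)) : psd X -> psd (ptraceA X).
Proof.
by move=> Xpsd; rewrite ptraceA_slot; apply: psd_sum => k; exact: psd_congr.
Qed.

Lemma tr_ptraceB M N (X : 'M[C]_(M * N)) : \tr (ptraceB X) = \tr X.
Proof. by rewrite /mxtrace sum_mxtens; apply: eq_bigr => i _; rewrite mxE. Qed.

Lemma tr_ptraceA M N (X : 'M[C]_(M * N)) : \tr (ptraceA X) = \tr X.
Proof.
by rewrite /mxtrace sum_mxtens exchange_big; apply: eq_bigr => i _; rewrite mxE.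
Qed.

Lemma tr_tens M N (A : 'M[C]_M) (B : 'M[C]_N) : \tr (A *t B) = \tr A * \tr B.
Proof.
rewrite /mxtrace sum_mxtens mulr_suml; apply: eq_bigr => i _.
by rewrite mulr_sumr; apply: eq_bigr => k _; rewrite tensmxE.
Qed.

Lemma tens_suml M N (I : finType) (F : I -> 'M[C]_M) (B : 'M[C]_N) :
  (\sum_i F i) *t B = \sum_i F i *t B.
Proof.
apply: matrix_tensP => i k j l; rewrite tensmxE !summxE mulr_suml.
by apply: eq_bigr => h _; rewrite tensmxE.
Qed.

Lemma tens_sumr M N (I : finType) (A : 'M[C]_M) (F : I -> 'M[C]_N) :
  A *t (\sum_i F i) = \sum_i A *t F i.
Proof.
apply: matrix_tensP => i k j l; rewrite tensmxE !summxE mulr_sumr.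
by apply: eq_bigr => h _; rewrite tensmxE.
Qed.

Lemma tensZl M N (a : C) (A : 'M[C]_M) (B : 'M[C]_N) : (a *: A) *t B = a *: (A *t B).
Proof. by apply/matrixP => i j; rewrite !mxE mulrA. Qed.

Lemma tensZr M N (a : C) (A : 'M[C]_M) (B : 'M[C]_N) : A *t (a *: B) = a *: (A *t B).
Proof. by apply/matrixP => i j; rewrite !mxE mulrCA. Qed.

Lemma tens1 M N : 1%:M *t 1%:M = 1%:M :> 'M[C]_(M * N).
Proof.
apply: matrix_tensP => i k j l; rewrite tensmxE !mxE.
by rewrite (inj_eq (can_inj (@mxtens_indexK M N))) xpair_eqE mulrb -mulnb natrM; case: eqP.
Qed.

Lemma tens_unitary M N (V : 'M[C]_M) (W : 'M[C]_N) :
  V \is unitarymx -> W \is unitarymx -> V *t W \is unitarymx.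
Proof.
move=> /unitarymxP Vu /unitarymxP Wu; apply/unitarymxP.
by rewrite adj_tens tensmx_mul Vu Wu tens1.
Qed.

Lemma tens_mulv M N M' N' (A : 'M[C]_(M', M)) (B : 'M[C]_(N', N)) v w :
  (A *t B) *m tensv v w = tensv (A *m v) (B *m w).
Proof.
apply/colP => r; rewrite -[r]mxtens_unindexK; case: (mxtens_unindex r) => i k.
rewrite tensvE !mxE sum_mxtens mulr_suml; apply: eq_bigr => j _.
rewrite mulr_sumr; apply: eq_bigr => l _.
by rewrite tensmxE tensvE; ring.
Qed.

Lemma tensv_form M N (v v' : 'cV[C]_M) (w w' : 'cV[C]_N) :
  ((tensv v w) ^t* *m tensv v' w') 0 0 =
  (v ^t* *m v') 0 0 * (w ^t* *m w') 0 0.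
Proof.
rewrite !mxE sum_mxtens mulr_suml; apply: eq_bigr => i _.
rewrite mulr_sumr; apply: eq_bigr => k _.
by rewrite !adjE !tensvE rmorphM; ring.
Qed.

Lemma mx_tens_sum M N (X : 'M[C]_(M * N)) :
  X = \sum_i \sum_j \sum_k \sum_l X (mxtens_index (i, k)) (mxtens_index (j, l))
        *: (delta_mx i j *t delta_mx k l).
Proof.
rewrite {1}[X]matrix_sum_delta sum_mxtens; apply: eq_bigr => i _.
rewrite exchange_big sum_mxtens /=; apply: eq_bigr => j _.
rewrite exchange_big /=; apply: eq_bigr => k _; apply: eq_bigr => l _.
congr (_ *: _); apply: matrix_tensP => i' k' j' l'.
rewrite tensmxE !mxE !(inj_eq (can_inj (@mxtens_indexK M N))) !xpair_eqE.
by rewrite -natrM mulnb andbACA.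
Qed.

Lemma ptraceB_sum M N (I : finType) (F : I -> 'M[C]_(M * N)) :
  ptraceB (\sum_i F i) = \sum_i ptraceB (F i).
Proof.
apply/matrixP => i j; rewrite mxE summxE.
under eq_bigr do rewrite summxE.
by rewrite exchange_big; apply: eq_bigr => k _; rewrite mxE.
Qed.

Lemma ptraceA_sum M N (I : finType) (F : I -> 'M[C]_(M * N)) :
  ptraceA (\sum_i F i) = \sum_i ptraceA (F i).
Proof.
apply/matrixP => i j; rewrite mxE summxE.
under eq_bigr do rewrite summxE.
by rewrite exchange_big; apply: eq_bigr => k _; rewrite mxE.
Qed.

Lemma ptraceBZ M N a (X : 'M[C]_(M * N)) : ptraceB (a *: X) = a *: ptraceB X.
Proof.
by apply/matrixP => i j; rewrite !mxE mulr_sumr; apply: eq_bigr => k _; rewrite mxE.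
Qed.

Lemma ptraceAZ M N a (X : 'M[C]_(M * N)) : ptraceA (a *: X) = a *: ptraceA X.
Proof.
by apply/matrixP => i j; rewrite !mxE mulr_sumr; apply: eq_bigr => k _; rewrite mxE.
Qed.

Lemma ptraceB_tens M N (A : 'M[C]_M) (B : 'M[C]_N) : ptraceB (A *t B) = \tr B *: A.
Proof.
apply/matrixP => i j; rewrite !mxE mulrC mulr_sumr.
by apply: eq_bigr => k _; rewrite tensmxE.
Qed.

Lemma ptraceA_tens M N (A : 'M[C]_M) (B : 'M[C]_N) : ptraceA (A *t B) = \tr A *: B.
Proof.
apply/matrixP => i j; rewrite !mxE mulr_suml.
by apply: eq_bigr => k _; rewrite tensmxE.
Qed.

Lemma tens_congr_sum M N M' N' (V : 'M[C]_(M', M)) (W : 'M[C]_(N', N))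
    (X : 'M[C]_(M * N)) :
  (V *t W) *m X *m (V *t W) ^t* =
  \sum_i \sum_j \sum_k \sum_l X (mxtens_index (i, k)) (mxtens_index (j, l))
     *: ((V *m delta_mx i j *m V ^t*) *t (W *m delta_mx k l *m W ^t*)).
Proof.
rewrite {1}[X]mx_tens_sum; do 4![rewrite mulmx_sumr mulmx_suml; apply: eq_bigr => ? _].
by rewrite -scalemxAr -scalemxAl adj_tens !tensmx_mul.
Qed.

Lemma unitary_congr_tr N (W A : 'M[C]_N) : W \is unitarymx ->
  \tr (W *m A *m W ^t*) = \tr A.
Proof. by move=> Wu; rewrite mxtrace_mulC mulmxA unitary_adj_mul // mul1mx. Qed.

(** By linearity it suffices to take matrix units, where the discarded factor contributes only a
    trace, invariant under the unitary [W]. *)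
Lemma ptraceB_congr M N (V : 'M[C]_M) (W : 'M[C]_N) (X : 'M[C]_(M * N)) :
  W \is unitarymx ->
  ptraceB ((V *t W) *m X *m (V *t W) ^t*) = V *m ptraceB X *m V ^t*.
Proof.
move=> Wu; rewrite tens_congr_sum [in RHS](mx_tens_sum X).
do 4![rewrite !ptraceB_sum mulmx_sumr mulmx_suml; apply: eq_bigr => ? _].
by rewrite !ptraceBZ !ptraceB_tens unitary_congr_tr // -!(scalemxAr, scalemxAl).
Qed.

Lemma ptraceA_congr M N (V : 'M[C]_M) (W : 'M[C]_N) (X : 'M[C]_(M * N)) :
  V \is unitarymx ->
  ptraceA ((V *t W) *m X *m (V *t W) ^t*) = W *m ptraceA X *m W ^t*.
Proof.
move=> Vu; rewrite tens_congr_sum [in RHS](mx_tens_sum X).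
do 4![rewrite !ptraceA_sum mulmx_sumr mulmx_suml; apply: eq_bigr => ? _].
by rewrite !ptraceAZ !ptraceA_tens unitary_congr_tr // -!(scalemxAr, scalemxAl).
Qed.

End Slots.

(** * Entropy *)

Section Entropy.
Variable R : realType.
Local Notation C := R[i].

Lemma ln2_gt0 : 0 < ln 2 :> R.
Proof. by apply: ln_gt0; rewrite ltr1n. Qed.

Lemma log2M (x y : R) : 0 < x -> 0 < y -> log2 (x * y) = log2 x + log2 y.
Proof. by move=> x0 y0; rewrite /log2 lnM // mulrDl. Qed.

Definition shannon (I : finType) (l : I -> R) : R := - \sum_i l i * log2 (l i).

Lemma sum_log2 (I : finType) (c x : I -> R) :
  \sum_i c i * log2 (x i) = (\sum_i c i * ln (x i)) / ln 2.
Proof. by rewrite mulr_suml; apply: eq_bigr => i _; rewrite mulrA. Qed.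

Lemma shannon_le_cross N (U : 'M[C]_N) l A V (y : 'I_N -> R) :
  eigdec U l A -> \sum_i l i = 1 -> V \is unitarymx ->
  (forall j, 0 <= y j) -> \sum_j y j <= 1 ->
  (forall j, y j = 0 -> (V *m A *m V ^t*) j j = 0) ->
  shannon l <= - \sum_j complex.Re ((V *m A *m V ^t*) j j) * log2 (y j).
Proof.
move=> UA l1 Vu y0 y1 yz; rewrite /shannon !sum_log2 -!mulNr.
rewrite ler_pM2r ?invr_gt0 ?ln2_gt0 //.
have Xu : V *m U ^t* \is unitarymx.
  by case: UA => Uu _ _; apply: mul_unitarymx; rewrite ?trmxC_unitary.
under [X in _ <= - X]eq_bigr do rewrite (eigdec_diag _ _ UA) /=.
apply: klein_scalar => //.
- by move=> j i; exact: sqn_ge0.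
- by move=> j; exact: unitary_row_sqn.
- by move=> j; exact: unitary_col_sqn.
- by case: UA.
- by move=> j /yz; rewrite (eigdec_diag _ _ UA) => -[].
Qed.

Lemma entropy_spectral N (A : 'M[C]_N) : psd A ->
  entropy A = shannon (fun i => complex.Re (spectral_diag A 0 i)).
Proof.
move=> /psd_spectral[Wu l0 AE]; rewrite /entropy /logmx invmx_unitary //.
congr (- _); set W := spectralmx A in Wu AE *; set D := diag_mx (map_mx _ _).
rewrite [X in X *m _]AE -!mulmxA (mulmxA W) (unitarymxP Wu) mul1mx.
rewrite mxtrace_mulC -mulmxA -(mulmxA D) (unitarymxP Wu) mulmx1.
rewrite /mxtrace Re_sum; apply: eq_bigr => i _.
by rewrite mul_diag_mx !mxE eqxx mulr1n ReZ.
Qed.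

(** Klein's inequality between two decompositions of the same matrix bounds each Shannon entropy by
    the other, so the two lists of eigenvalues never have to be matched by a permutation. *)
Lemma entropy_eigdec N (W : 'M[C]_N) l A :
  eigdec W l A -> \sum_i l i = 1 -> entropy A = shannon l.
Proof.
move=> WA l1; have Apsd := eigdec_psd WA.
have SA := psd_spectral Apsd; rewrite entropy_spectral //.
have trE := eigdec_tr WA; have trS := eigdec_tr SA.
set m := (fun i => _) in SA trS *.
have m1 : \sum_i m i = 1 by rewrite -l1; apply: complexI; rewrite -trE -trS.
have cross U1 k1 U2 k2 : eigdec U1 k1 A -> \sum_i k1 i = 1 ->
    eigdec U2 k2 A -> \sum_i k2 i = 1 -> shannon k1 <= shannon k2.
  move=> h1 s1 h2 s2; apply: (le_trans (@shannon_le_cross _ _ _ _ U2 k2 h1 s1 _ _ _ _)).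
  - by case: h2.
  - by case: h2.
  - by rewrite s2.
  - by move=> j; rewrite (eigdec_eigen _ h2) => ->.
  - rewrite lerN2; apply: ler_sum => j _.
    by rewrite (eigdec_eigen _ h2).
by apply/eqP; rewrite eq_le (cross _ _ _ _ SA m1 WA l1) (cross _ _ _ _ WA l1 SA m1).
Qed.

Lemma state_eigdec N (A : 'M[C]_N) : is_state A ->
  exists W l, [/\ eigdec W l A, \sum_i l i = 1 & entropy A = shannon l].
Proof.
move=> [/psd_spectral SA trA].
exists (spectralmx A), (fun i => complex.Re (spectral_diag A 0 i)).
have s1 : \sum_i complex.Re (spectral_diag A 0 i) = 1.
  by apply: complexI; rewrite -(eigdec_tr SA) trA.
by split => //; exact: entropy_eigdec SA s1.
Qed.

Lemma entropy_le_cross N (A V : 'M[C]_N) (y : 'I_N -> R) :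
  is_state A -> V \is unitarymx ->
  (forall j, 0 <= y j) -> \sum_j y j <= 1 ->
  (forall j, y j = 0 -> (V *m A *m V ^t*) j j = 0) ->
  entropy A <= - \sum_j complex.Re ((V *m A *m V ^t*) j j) * log2 (y j).
Proof.
by move=> /state_eigdec[W [l [WA l1 ->]]] ? ? ? ?; exact: (shannon_le_cross WA).
Qed.

Lemma entropy_ge0 N (A : 'M[C]_N) : is_state A -> 0 <= entropy A.
Proof.
move=> /state_eigdec[W [l [[_ l0 _] l1 ->]]].
rewrite oppr_ge0; apply: sumr_le0 => i _.
rewrite mulr_ge0_le0 // mulr_le0_ge0 ?invr_ge0 ?(ltW ln2_gt0) //.
by rewrite ln_le0 // -l1 (bigD1 i) //= lerDl sumr_ge0.
Qed.

Lemma state_dim_gt0 N (A : 'M[C]_N) : is_state A -> (0 < N)%N.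
Proof.
case: N A => // A [_ /esym/eqP].
by rewrite /mxtrace big_ord0 oner_eq0.
Qed.

(** Klein's inequality against the maximally mixed state. *)
Lemma entropy_le_log2 N (A : 'M[C]_N) : is_state A -> entropy A <= log2 N%:R.
Proof.
move=> Ast; have N0 := state_dim_gt0 Ast.
have N0R : 0 < N%:R :> R by rewrite ltr0n.
apply: (le_trans (@entropy_le_cross _ _ 1%:M (fun=> N%:R^-1) Ast _ _ _ _)).
- by apply/unitarymxP; rewrite trmx1 map_mx1 mulmx1.
- by move=> _; rewrite invr_ge0 ltW.
- by rewrite sumr_const card_ord -(mulr_natr N%:R^-1) mulVf ?gt_eqF.
- by move=> j /eqP; rewrite invr_eq0 gt_eqF.
- rewrite trmx1 map_mx1 mulmx1 mul1mx -mulr_suml -Re_sum.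
  by have [_] := Ast; rewrite /mxtrace => ->; rewrite mul1r /log2 lnV // mulNr opprK.
Qed.

Lemma eigdec_tens M N W l (A : 'M[C]_M) V m (B : 'M[C]_N) :
  eigdec W l A -> eigdec V m B ->
  eigdec (W *t V) (fun r => l (mxtens_unindex r).1 * m (mxtens_unindex r).2) (A *t B).
Proof.
move=> [Wu l0 ->] [Vu m0 ->]; split; first exact: tens_unitary.
  by move=> r; rewrite mulr_ge0.
have <- : diag_mx (\row_i (l i)%:C) *t diag_mx (\row_i (m i)%:C) = diag_mx (\row_r
    (l (mxtens_unindex r).1 * m (mxtens_unindex r).2)%:C) :> 'M[C]_(M * N).
  apply: matrix_tensP => i k j l'; rewrite tensmxE !mxE mxtens_indexK /=.
  rewrite (inj_eq (can_inj (@mxtens_indexK M N))) xpair_eqE.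
  by case: eqP => _; case: eqP => _; rewrite ?mulr0n ?mul0r ?mulr0 ?mulr1n ?rmorphM.
by rewrite adj_tens !tensmx_mul.
Qed.

Lemma is_state_tens M N (A : 'M[C]_M) (B : 'M[C]_N) :
  is_state A -> is_state B -> is_state (A *t B).
Proof.
move=> [/psd_spectral Ap Atr] [/psd_spectral Bp Btr]; split.
  exact: eigdec_psd (eigdec_tens Ap Bp).
by rewrite tr_tens Atr Btr mulr1.
Qed.

Lemma is_state_mix (T : finType) N (p : T -> R) (rho : T -> 'M[C]_N) :
  (forall k, 0 <= p k) -> \sum_k p k = 1 -> (forall k, is_state (rho k)) ->
  is_state (\sum_k (p k)%:C *: rho k).
Proof.
move=> p0 p1 rhos; split; first by apply: psd_sum => k; apply: psdZ => //; case: (rhos k).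
rewrite raddf_sum /= -[RHS](congr1 (fun x => x%:C) p1) real_sum.
by apply: eq_bigr => k _; rewrite mxtraceZ (proj2 (rhos k)) mulr1.
Qed.

Lemma xlog2xM (x y : R) : 0 <= x -> 0 <= y ->
  (x * y) * log2 (x * y) = y * (x * log2 x) + x * (y * log2 y).
Proof.
rewrite le_eqVlt => /predU1P[<- _|x0]; first by rewrite !mul0r mulr0 add0r.
rewrite le_eqVlt => /predU1P[<-|y0]; first by rewrite mulr0 !mul0r mulr0 add0r.
by rewrite log2M //; ring.
Qed.

Lemma entropy_tens M N (A : 'M[C]_M) (B : 'M[C]_N) :
  is_state A -> is_state B -> entropy (A *t B) = entropy A + entropy B.
Proof.
move=> /state_eigdec[W [l [WA l1 ->]]] /state_eigdec[V [m [VB m1 ->]]].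
rewrite (entropy_eigdec (eigdec_tens WA VB)); last first.
  rewrite sum_mxtens -[RHS]l1; apply: eq_bigr => i _.
  by under eq_bigr do rewrite mxtens_indexK /=; rewrite -mulr_sumr m1 mulr1.
case: WA => _ l0 _; case: VB => _ m0 _.
rewrite /shannon -opprD sum_mxtens; congr (- _).
under eq_bigr do under eq_bigr do rewrite mxtens_indexK /= xlog2xM //.
under eq_bigr do rewrite big_split /= -mulr_suml -mulr_sumr m1 mul1r.
by rewrite big_split /= -mulr_suml l1 mul1r.
Qed.

Lemma is_state_ptraceB M N (X : 'M[C]_(M * N)) : is_state X -> is_state (ptraceB X).
Proof. by move=> [? ?]; split; [exact: psd_ptraceB|rewrite tr_ptraceB]. Qed.

Lemma is_state_ptraceA M N (X : 'M[C]_(M * N)) : is_state X -> is_state (ptraceA X).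
Proof. by move=> [? ?]; split; [exact: psd_ptraceA|rewrite tr_ptraceA]. Qed.

Lemma diag_tens_sumB M N (V : 'M[C]_M) (W : 'M[C]_N) (X : 'M[C]_(M * N)) i :
  W \is unitarymx ->
  \sum_k ((V *t W) *m X *m (V *t W) ^t*) (mxtens_index (i, k)) (mxtens_index (i, k)) =
  (V *m ptraceB X *m V ^t*) i i.
Proof. by move=> Wu; rewrite -(ptraceB_congr V X Wu) [RHS]mxE. Qed.

Lemma diag_tens_sumA M N (V : 'M[C]_M) (W : 'M[C]_N) (X : 'M[C]_(M * N)) k :
  V \is unitarymx ->
  \sum_i ((V *t W) *m X *m (V *t W) ^t*) (mxtens_index (i, k)) (mxtens_index (i, k)) =
  (W *m ptraceA X *m W ^t*) k k.
Proof. by move=> Wu; rewrite -(ptraceA_congr W X Wu) [RHS]mxE. Qed.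

(** Klein's inequality against the product of the marginals. In the product of their eigenbases the
    diagonal [y i k] of [X] is a joint distribution with marginals [l] and [m], so the cross term
    splits into the two Shannon entropies. *)
Lemma entropy_subadditive M N (X : 'M[C]_(M * N)) : is_state X ->
  entropy X <= entropy (ptraceB X) + entropy (ptraceA X).
Proof.
move=> Xst.
have [V [l [VA l1 ->]]] := state_eigdec (is_state_ptraceB Xst).
have [W [m [WB m1 ->]]] := state_eigdec (is_state_ptraceA Xst).
have [Vu l0 _] := VA; have [Wu m0 _] := WB.
pose Y := (V *t W) *m X *m (V *t W) ^t*.
have Y0 r : 0 <= Y r r.
  apply: psd_diag; rewrite /Y -{1}[V *t W]trmxCK; apply: psd_congr.
  by case: Xst.
pose y i k := complex.Re (Y (mxtens_index (i, k)) (mxtens_index (i, k))).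
have y0 i k : 0 <= y i k by rewrite -ler0c -ge0_Re.
have yl i : \sum_k y i k = l i.
  by rewrite -Re_sum diag_tens_sumB // (eigdec_eigen _ VA).
have ym k : \sum_i y i k = m k.
  by rewrite -Re_sum diag_tens_sumA // (eigdec_eigen _ WB).
have yz i k : l i * m k = 0 -> y i k = 0.
  move=> /eqP; rewrite mulf_eq0 -(yl i) -(ym k).
  by case/orP; rewrite psumr_eq0 // => /allP h; apply/eqP; apply: h;
    rewrite mem_index_enum.
apply: (le_trans (@entropy_le_cross _ _ (V *t W)
  (fun r => l (mxtens_unindex r).1 * m (mxtens_unindex r).2) Xst _ _ _ _)).
- exact: tens_unitary.
- by move=> r; rewrite mulr_ge0.
- rewrite sum_mxtens le_eqVlt; apply/orP; left; apply/eqP.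
  rewrite -[RHS]l1; apply: eq_bigr => i _.
  by under eq_bigr do rewrite mxtens_indexK /=; rewrite -mulr_sumr m1 mulr1.
- move=> r; rewrite -[r]mxtens_unindexK; case: (mxtens_unindex r) => i k.
  by rewrite mxtens_indexK /= => /yz yik; rewrite -/Y [LHS]ge0_Re //; congr (_%:C).
rewrite sum_mxtens /shannon -opprD lerN2 le_eqVlt; apply/orP; left; apply/eqP.
transitivity (\sum_i \sum_k (y i k * log2 (l i) + y i k * log2 (m k))).
  symmetry; under eq_bigr do rewrite big_split /=.
  rewrite big_split /=; congr (_ + _); last rewrite exchange_big.
    by apply: eq_bigr => i _; rewrite -mulr_suml yl.
  by apply: eq_bigr => k _; rewrite -mulr_suml ym.
apply: eq_bigr => i _; apply: eq_bigr => k _.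
rewrite mxtens_indexK /= -/Y -[complex.Re _]/(y i k) -mulrDr.
have [yik|yik] := eqVneq (y i k) 0; first by rewrite yik !mul0r.
have li : l i != 0 by apply: contra_neq yik => li; rewrite yz // li mul0r.
have mk : m k != 0 by apply: contra_neq yik => mk; rewrite yz // mk mulr0.
by rewrite log2M // lt_def ?li ?mk ?l0 ?m0.
Qed.

End Entropy.

(** * Entropy of classical-quantum states with pure labels *)

Section CqEntropy.
Variable R : realType.
Local Notation C := R[i].

Definition proj N (v : 'cV[C]_N) : 'M[C]_N := v *m v ^t*.

Lemma projE N (v : 'cV[C]_N) i j : proj v i j = v i 0 * (v j 0)^*.
Proof. by rewrite mxE big_ord1 adjE. Qed.

Lemma psd_proj N (v : 'cV[C]_N) : psd (proj v).
Proof.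
move=> w; rewrite mulmxA -mulmxA.
have -> : v ^t* *m w = (w ^t* *m v) ^t* by rewrite adjM trmxCK.
by rewrite mxE big_ord1 adjE mul_conjC_ge0.
Qed.

Lemma tr_proj N (v : 'cV[C]_N) : \tr (proj v) = (v ^t* *m v) 0 0.
Proof. by rewrite mxtrace_mulC /mxtrace big_ord1. Qed.

Lemma is_state_proj N (v : 'cV[C]_N) : (v ^t* *m v) 0 0 = 1 -> is_state (proj v).
Proof. by move=> v1; split; [exact: psd_proj|rewrite tr_proj]. Qed.

Lemma proj_congr_diag M N (U : 'M[C]_(M, N)) (v : 'cV[C]_N) i :
  (U *m proj v *m U ^t*) i i = (sqn ((U *m v) i 0))%:C.
Proof. by rewrite mulmxA -mulmxA -adjM -/(proj _) projE sqnE. Qed.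

Lemma proj_tens M N (v : 'cV[C]_M) (w : 'cV[C]_N) :
  proj v *t proj w = proj (tensv v w).
Proof.
apply: matrix_tensP => i k j l.
by rewrite tensmxE !projE !tensvE rmorphM mulrACA.
Qed.

Lemma eigdec_sum N (W : 'M[C]_N) l A : eigdec W l A ->
  A = \sum_j (l j)%:C *: proj (W ^t* *m delta_mx j 0).
Proof.
case=> _ _ ->; apply/matrixP => a b; rewrite mxE summxE; apply: eq_bigr => j _.
by rewrite mul_mx_diag [RHS]mxE projE -!colE !mxE conjCK; ring.
Qed.

Lemma unitary_form N (U : 'M[C]_N) (v w : 'cV[C]_N) : U \is unitarymx ->
  (U *m v) ^t* *m (U *m w) = v ^t* *m w.
Proof. by move=> Uu; rewrite adjM -mulmxA (mulmxA _ U) unitary_adj_mul // mul1mx. Qed.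

Lemma form_basis_ptraceB M N (W : 'M[C]_N) (Y : 'M[C]_(M * N)) (v : 'cV[C]_M) :
  W \is unitarymx ->
  (v ^t* *m ptraceB Y *m v) 0 0 =
  \sum_j ((tensv v (W ^t* *m delta_mx j 0)) ^t* *m Y
            *m tensv v (W ^t* *m delta_mx j 0)) 0 0.
Proof.
move=> Wu; have := ptraceB_congr 1%:M Y Wu.
rewrite trmx1 map_mx1 mulmx1 mul1mx => <-.
rewrite ptraceB_slot mulmx_sumr mulmx_suml summxE; apply: eq_bigr => j _.
have E : tensv v (W ^t* *m delta_mx j 0) =
    (1%:M *t W) ^t* *m (slotB M (delta_mx j 0) *m v).
  by rewrite slotB_mulv adj_tens trmx1 map_mx1 tens_mulv mul1mx.
by rewrite E !adjM !trmxCK !mulmxA.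
Qed.

(** This is [|a - y b|^2 >= 0] divided by [y], with equality at [b = a / y]. The left side is affine
    in [y], which is what lets it commute with averaging. *)
Lemma sqn_div_ge (a b : C) (y : R) : 0 < y ->
  2 * complex.Re (a^* * b) - y * sqn b <= sqn a / y.
Proof.
move=> y0; rewrite ler_pdivlMr //; case: a => a1 a2; case: b => b1 b2.
rewrite /sqn /=; have := sqr_ge0 (a1 - y * b1); have := sqr_ge0 (a2 - y * b2).
by nra.
Qed.

Lemma Re_form N (v w : 'cV[C]_N) :
  complex.Re ((v ^t* *m w) 0 0) = \sum_i complex.Re ((v i 0)^* * w i 0).
Proof. by rewrite mxE Re_sum; apply: eq_bigr => i _; rewrite adjE. Qed.

Lemma unit_basis N (W : 'M[C]_N) j : W \is unitarymx ->
  ((W ^t* *m delta_mx j 0) ^t* *m (W ^t* *m delta_mx j 0) : 'M[C]_1) 0 0 = 1.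
Proof.
move=> Wu; rewrite unitary_form ?trmxC_unitary //.
by rewrite trmx_delta map_delta_mx mul_delta_mx mxE.
Qed.

(* Operator Jensen: the quadratic lower bound [sqn_div_ge] is applied to
   [phi (x) f_j] with [phi] the resolvent of [ptraceB Y] applied to [psi]. *)
Lemma resolvent_ptraceB M N (Y : 'M[C]_(M * N)) U x G x' (psi : 'cV[C]_M)
    (W : 'M[C]_N) (t : 'I_N -> R) (s : R) :
  eigdec U x Y -> eigdec G x' (ptraceB Y) -> W \is unitarymx ->
  (forall j, 0 <= t j) -> \sum_j t j = 1 -> 0 < s ->
  \sum_l sqn ((G *m psi) l 0) / (x' l + s) <=
  \sum_j \sum_i t j * sqn ((U *m tensv psi (W ^t* *m delta_mx j 0)) i 0)
                / (x i / t j + s).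
Proof.
move=> UY GY Wu t0 t1 s0; have [Uu x0 _] := UY; have [Gu x0' _] := GY.
pose f j := W ^t* *m delta_mx j 0 : 'cV[C]_N.
pose g := \col_l ((G *m psi) l 0 * ((x' l + s)^-1)%:C).
pose phi := G ^t* *m g.
have Gphi : G *m phi = g by rewrite mulmxA (unitarymxP Gu) mul1mx.
pose a j i := (U *m tensv psi (f j)) i 0; pose b j i := (U *m tensv phi (f j)) i 0.
have xs l : 0 < x' l + s by rewrite ltr_wpDl.
have ReE : complex.Re ((psi ^t* *m phi) 0 0) = \sum_l sqn ((G *m psi) l 0) / (x' l + s).
  rewrite -(unitary_form _ _ Gu) Gphi Re_form; apply: eq_bigr => l _.
  rewrite [g l 0]mxE mulrA [_^* * _]mulrC -sqnE -rmorphM /=; ring.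
have normE : (phi ^t* *m phi) 0 0 = (\sum_l sqn (g l 0))%:C.
  by rewrite -(unitary_form _ _ Gu) Gphi form_norm.
have YAE : (phi ^t* *m ptraceB Y *m phi) 0 0 = (\sum_l x' l * sqn (g l 0))%:C.
  by rewrite (eigdec_form _ GY) Gphi.
have gE l : (x' l + s) * sqn (g l 0) = sqn ((G *m psi) l 0) / (x' l + s).
  by rewrite [g l 0]mxE sqnM sqn_real; field; rewrite gt_eqF.
have ab j : \sum_i complex.Re ((a j i)^* * b j i) = complex.Re ((psi ^t* *m phi) 0 0).
  by rewrite -Re_form (unitary_form _ _ Uu) tensv_form unit_basis // mulr1.
have bb j : \sum_i sqn (b j i) = \sum_l sqn (g l 0).
  apply: complexI; rewrite -form_norm (unitary_form _ _ Uu) tensv_form.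
  by rewrite unit_basis // mulr1 normE.
have bY : \sum_j \sum_i x i * sqn (b j i) = \sum_l x' l * sqn (g l 0).
  apply: complexI; rewrite -YAE (form_basis_ptraceB _ _ Wu) real_sum.
  by apply: eq_bigr => j _; rewrite (eigdec_form _ UY).
(* Multiplying the bound for [y = x i / t j + s] by [t j] turns the term in [x i / t j] into one in
   [x i]. Summed over [j] these terms give the form of [ptraceB Y] at [phi], and the total is
   [2 <psi|phi> - <phi|(ptraceB Y + s)|phi>], which is the left-hand side by the choice of [phi]. *)
apply: (@le_trans _ _ (\sum_j \sum_i
    (t j * (2 * complex.Re ((a j i)^* * b j i) - s * sqn (b j i)) - x i * sqn (b j i)))).
  under [X in _ <= X]eq_bigr do rewrite sumrB -mulr_sumr sumrB -mulr_sumr ab -mulr_sumr bb.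
  rewrite sumrB -mulr_suml t1 mul1r bY ReE mulr_sumr mulr_sumr -sumrB -sumrB.
  apply: ler_sum => l _; rewrite -addrA -opprD -mulrDl [s + _]addrC gE; lra.
apply: ler_sum => j _; apply: ler_sum => i _; rewrite -/(a j i).
(* For [t j = 0] the right-hand term is zero, and the lower bound is [- x i * sqn (b j i) <= 0]. *)
have [tj|tj] := eqVneq (t j) 0.
  by rewrite tj !mul0r sub0r oppr_le0 mulr_ge0 ?sqn_ge0.
have tp : 0 < t j by rewrite lt_def tj t0.
have y0 : 0 < x i / t j + s by rewrite ltr_wpDl // divr_ge0 // ltW.
have := ler_wpM2l (t0 j) (sqn_div_ge (a j i) (b j i) y0); rewrite mulrA.
apply: le_trans; rewrite le_eqVlt; apply/orP; left; apply/eqP.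
by field.
Qed.

(** In terms of relative entropy: [D (psi || ptraceB Y) <= D (psi (x) tau || Y)], with the entropy
    of [proj psi] being zero. [kx] and [kx'] say that both divergences are finite. *)
Lemma relative_entropy_pure M N (Y : 'M[C]_(M * N)) U x G x' (psi : 'cV[C]_M)
    (tau : 'M[C]_N) :
  eigdec U x Y -> eigdec G x' (ptraceB Y) ->
  (psi ^t* *m psi) 0 0 = 1 -> is_state tau ->
  (forall i, x i = 0 -> (U *m (proj psi *t tau) *m U ^t*) i i = 0) ->
  (forall l, x' l = 0 -> (G *m proj psi *m G ^t*) l l = 0) ->
  \sum_i complex.Re ((U *m (proj psi *t tau) *m U ^t*) i i) * log2 (x i)
    + entropy tau <=
  \sum_l complex.Re ((G *m proj psi *m G ^t*) l l) * log2 (x' l).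
Proof.
move=> UY GY psi1 /state_eigdec[W [t [Wt t1 ->]]] kx kx'.
have [Wu t0 _] := Wt; have [Uu x0 _] := UY; have [Gu x0' _] := GY.
pose f j := W ^t* *m delta_mx j 0 : 'cV[C]_N.
pose a j i := sqn ((U *m tensv psi (f j)) i 0).
have UE i : complex.Re ((U *m (proj psi *t tau) *m U ^t*) i i) = \sum_j t j * a j i.
  rewrite (eigdec_sum Wt) tens_sumr mulmx_sumr mulmx_suml summxE Re_sum.
  apply: eq_bigr => j _; rewrite tensZr -scalemxAr -scalemxAl mxE proj_tens.
  by rewrite proj_congr_diag ReZ.
have GE l : complex.Re ((G *m proj psi *m G ^t*) l l) = sqn ((G *m psi) l 0).
  by rewrite proj_congr_diag.
have a1 j : \sum_i a j i = 1.
  apply: complexI; rewrite -form_norm (unitary_form _ _ Uu) tensv_form unit_basis //.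
  by rewrite psi1 mulr1.
have ta0 i j : x i = 0 -> t j * a j i = 0.
  move=> /kx /(congr1 (@complex.Re R)); rewrite UE => /eqP.
  rewrite psumr_eq0 => [/allP/(_ j)|k _]; last by rewrite mulr_ge0 ?sqn_ge0.
  by rewrite mem_index_enum => /(_ isT)/eqP.
(* Pairs [(j, i)] carry the probability that an eigenvector [f j] of [tau] is drawn and
   [psi (x) f j] is then found in the [i]-th eigenvector of [Y]; [x i / t j] is the matching point
   of the spectrum of [Y / t j]. *)
have key : \sum_(k : 'I_N * 'I_(M * N)) t k.1 * a k.1 k.2 * ln (x k.2 / t k.1) <=
    \sum_l sqn ((G *m psi) l 0) * ln (x' l).
  apply: le_sum_ln_of_resolvent.
  - by move=> k; rewrite mulr_ge0 ?sqn_ge0.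
  - by move=> k; rewrite divr_ge0.
  - move=> [j i] /= /eqP; rewrite mulf_eq0 invr_eq0 => /orP[/eqP/ta0//|/eqP->].
    by rewrite mul0r.
  - by move=> l; exact: sqn_ge0.
  - by [].
  - by move=> l /kx' /(congr1 (@complex.Re R)); rewrite GE.
  - rewrite -(pair_bigA _ (fun j i => t j * a j i)) /=.
    under eq_bigr do rewrite -mulr_sumr a1 mulr1.
    rewrite t1; apply: complexI; rewrite -form_norm (unitary_form _ _ Gu) psi1.
    by [].
  - move=> s s0; rewrite -(pair_bigA _ (fun j i => t j * a j i / (x i / t j + s))) /=.
    exact: (resolvent_ptraceB psi UY GY Wu t0 t1 s0).
under eq_bigr do rewrite UE; under [X in _ <= X]eq_bigr do rewrite GE.
rewrite /shannon !sum_log2 -mulNr -mulrDl ler_pM2r ?invr_gt0 ?ln2_gt0 //.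
apply: le_trans key; rewrite -(pair_bigA _ (fun j i => t j * a j i * ln (x i / t j))) /=.
rewrite le_eqVlt; apply/orP; left; apply/eqP.
transitivity (\sum_j \sum_i (t j * a j i * ln (x i) - a j i * (t j * ln (t j)))).
  symmetry; under [LHS]eq_bigr do rewrite sumrB -mulr_suml a1 mul1r.
  rewrite sumrB exchange_big; congr (_ - _).
  by apply: eq_bigr => i _; rewrite mulr_suml.
apply: eq_bigr => j _; apply: eq_bigr => i _.
have [ta|] := eqVneq (t j * a j i) 0.
  by rewrite [a j i * _]mulrA [a j i * _]mulrC ta !mul0r subr0.
move=> tan; have xi : 0 < x i.
  by rewrite lt_def x0 andbT; apply: contra_neq tan => /ta0.
have tj : 0 < t j.
  by rewrite lt_def t0 andbT; apply: contra_neq tan => ->; rewrite mul0r.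
by rewrite ln_div //; ring.
Qed.

(* Monotonicity of the Holevo quantity of the ensemble [proj (psi k) *t tau k] under
   the partial trace over the second factor. *)
Lemma entropy_cq_ge (T : finType) M N (q : T -> R) (psi : T -> 'cV[C]_M)
    (tau : T -> 'M[C]_N) (Y : 'M[C]_(M * N)) :
  (forall k, 0 <= q k) -> \sum_k q k = 1 ->
  (forall k, ((psi k) ^t* *m psi k) 0 0 = 1) -> (forall k, is_state (tau k)) ->
  Y = \sum_k (q k)%:C *: (proj (psi k) *t tau k) ->
  entropy (ptraceB Y) + \sum_k q k * entropy (tau k) <= entropy Y.
Proof.
move=> q0 q1 psi1 taus YE.
have comps k : is_state (proj (psi k) *t tau k).
  by apply: is_state_tens => //; exact: is_state_proj.
have Yst : is_state Y by rewrite YE; exact: is_state_mix.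
have YAE : ptraceB Y = \sum_k (q k)%:C *: proj (psi k).
  rewrite YE ptraceB_sum; apply: eq_bigr => k _.
  by rewrite ptraceBZ ptraceB_tens (proj2 (taus k)) scale1r.
have [U [x [UY x1 ->]]] := state_eigdec Yst.
have [G [x' [GY x1' ->]]] := state_eigdec (is_state_ptraceB Yst).
pose r k i := complex.Re ((U *m (proj (psi k) *t tau k) *m U ^t*) i i).
pose r' k l := complex.Re ((G *m proj (psi k) *m G ^t*) l l).
have P0 k i : 0 <= (U *m (proj (psi k) *t tau k) *m U ^t*) i i.
  apply: psd_diag; rewrite -{1}[U]trmxCK; apply: psd_congr.
  by case: (comps k).
have P0' k l : 0 <= (G *m proj (psi k) *m G ^t*) l l.
  by rewrite proj_congr_diag ler0c sqn_ge0.
have r0 k i : 0 <= r k i by rewrite -ler0c -ge0_Re.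
have r0' k i : 0 <= r' k i by rewrite -ler0c -ge0_Re.
have xE i : x i = \sum_k q k * r k i.
  apply: complexI; rewrite -(eigdec_eigen _ UY) {1}YE mulmx_sumr mulmx_suml summxE.
  rewrite real_sum; apply: eq_bigr => k _.
  by rewrite -scalemxAr -scalemxAl mxE rmorphM /= -ge0_Re.
have xE' l : x' l = \sum_k q k * r' k l.
  apply: complexI; rewrite -(eigdec_eigen _ GY) {1}YAE mulmx_sumr mulmx_suml summxE.
  rewrite real_sum; apply: eq_bigr => k _.
  by rewrite -scalemxAr -scalemxAl mxE rmorphM /= -ge0_Re.
(* Only components of positive weight have their support inside that of [Y]; those with [q k = 0]
   are discarded before [relative_entropy_pure] is applied. *)
have each k : q k * (\sum_i r k i * log2 (x i) + entropy (tau k)) <=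
    q k * \sum_l r' k l * log2 (x' l).
  have [->|qk] := eqVneq (q k) 0; first by rewrite !mul0r.
  rewrite ler_wpM2l //; apply: (relative_entropy_pure UY GY) => //.
    move=> i; rewrite xE => /eqP; rewrite psumr_eq0 => [/allP/(_ k)|? _].
      rewrite mem_index_enum mulf_eq0 (negPf qk) => /(_ isT)/eqP rk.
      by rewrite [LHS]ge0_Re // -[complex.Re _]/(r k i) rk.
    by rewrite mulr_ge0.
  move=> l; rewrite xE' => /eqP; rewrite psumr_eq0 => [/allP/(_ k)|? _].
    rewrite mem_index_enum mulf_eq0 (negPf qk) => /(_ isT)/eqP rk.
    by rewrite [LHS]ge0_Re // -[complex.Re _]/(r' k l) rk.
  by rewrite mulr_ge0.
(* Averaged over [k], the diagonals of the components are the eigenvalues themselves, so the cross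
   terms collapse to the Shannon sums of [Y] and of its marginal. *)
have sumE (I : finType) (rr : T -> I -> R) (z : I -> R) :
    (forall i, z i = \sum_k q k * rr k i) ->
    \sum_k q k * \sum_i rr k i * log2 (z i) = \sum_i z i * log2 (z i).
  move=> zE; under [LHS]eq_bigr do rewrite mulr_sumr.
  rewrite exchange_big; apply: eq_bigr => i _ /=.
  by rewrite [in RHS]zE mulr_suml; apply: eq_bigr => k _; rewrite mulrA -zE.
have : \sum_k q k * (\sum_i r k i * log2 (x i) + entropy (tau k)) <=
       \sum_k q k * \sum_l r' k l * log2 (x' l).
  by apply: ler_sum => k _; exact: each.
under [X in X <= _]eq_bigr do rewrite mulrDr.
by rewrite big_split /= !sumE // /shannon; lra.
Qed.

End CqEntropy.

(** * Measure-and-prepare maps *)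

Section MeasurePrepare.
Variable R : realType.
Local Notation C := R[i].

Lemma sum_enum_val (V : nmodType) (T : finType) (F : T -> V) :
  \sum_(k < #|T|) F (enum_val k) = \sum_x F x.
Proof.
rewrite (reindex _ (onW_bij _ (@enum_rank_bij T))).
by apply: eq_bigr => x _; rewrite enum_rankK.
Qed.

Lemma psd_tens M N (A : 'M[C]_M) (B : 'M[C]_N) : psd A -> psd B -> psd (A *t B).
Proof.
by move=> /psd_spectral Ap /psd_spectral Bp; exact: eigdec_psd (eigdec_tens Ap Bp).
Qed.

Lemma psd_tr0 N (A : 'M[C]_N) : psd A -> \tr A = 0 -> A = 0.
Proof.
move=> /psd_spectral SA; rewrite (eigdec_tr SA) => -[/eqP].
case: SA => _ l0 {2}->; rewrite psumr_eq0 // => /allP lz.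
rewrite (_ : \row_i _ = 0) ?diag_mx0 ?mulmx0 ?mul0mx //.
  by rewrite raddf0 mulmx0 mul0mx.
by apply/rowP => i; rewrite !mxE; have /eqP -> := lz i (mem_index_enum i).
Qed.

Lemma is_state_delta N (i : 'I_N) : is_state (proj (delta_mx i 0) : 'M[C]_N).
Proof.
apply: is_state_proj.
by rewrite trmx_delta map_delta_mx mul_delta_mx mxE.
Qed.

(** A matrix of trace zero is zero, and then any state serves as [alpha]: measurement outcomes of
    probability zero still receive a state. *)
Lemma psd_normalize N (A : 'M[C]_N) : (0 < N)%N -> psd A ->
  exists alpha, is_state alpha /\ A = (complex.Re (\tr A))%:C *: alpha.
Proof.
move=> N0 Apsd; have trE := ge0_Re (psd_tr_ge0 Apsd).
have [tr0|trn] := eqVneq (complex.Re (\tr A)) 0.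
  exists (proj (delta_mx (Ordinal N0) 0)); split; first exact: is_state_delta.
  by rewrite tr0 scale0r; apply: psd_tr0 => //; rewrite trE tr0.
exists (((complex.Re (\tr A))^-1)%:C *: A); split; last first.
  by rewrite scalerA -rmorphM /= divff // scale1r.
split; first by apply: psdZ => //; rewrite invr_ge0 -ler0c -trE psd_tr_ge0.
by rewrite mxtraceZ [X in _ * X]trE -rmorphM /= mulVf.
Qed.

Lemma lin0 a b (f : 'M[C]_a -> 'M[C]_b) : linear f -> f 0 = 0.
Proof.
move=> fl; have := fl 1 0 0; rewrite !scale1r addr0 => /eqP.
by rewrite -subr_eq0 opprD addrA subrr sub0r oppr_eq0 => /eqP.
Qed.

Lemma linZ a b (f : 'M[C]_a -> 'M[C]_b) c A : linear f -> f (c *: A) = c *: f A.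
Proof. by move=> fl; have := fl c A 0; rewrite (lin0 fl) !addr0. Qed.

Lemma lin_sum a b (f : 'M[C]_a -> 'M[C]_b) (I : finType) (F : I -> 'M[C]_a) :
  linear f -> f (\sum_i F i) = \sum_i f (F i).
Proof.
move=> fl; elim/big_rec2 : _ => [|i A B _ <-]; first exact: lin0.
by have := fl 1 (F i) B; rewrite !scale1r.
Qed.

Lemma lin_delta a b (f : 'M[C]_a -> 'M[C]_b) A : linear f ->
  f A = \sum_i \sum_j A i j *: f (delta_mx i j).
Proof.
move=> fl; rewrite {1}[A]matrix_sum_delta lin_sum //; apply: eq_bigr => i _.
by rewrite lin_sum //; apply: eq_bigr => j _; rewrite linZ.
Qed.

Lemma tens_map_tens a b a' b' (f : 'M[C]_a -> 'M[C]_b) (g : 'M[C]_a' -> 'M[C]_b') A B :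
  linear f -> linear g -> tens_map f g (A *t B) = f A *t g B.
Proof.
move=> fl gl; rewrite (lin_delta A fl) (lin_delta B gl) tens_suml.
apply: eq_bigr => i _; rewrite tens_suml; apply: eq_bigr => j _.
rewrite tens_sumr; apply: eq_bigr => k _; rewrite tens_sumr; apply: eq_bigr => l _.
by rewrite tensmxE tensZl tensZr scalerA.
Qed.

Lemma slotA_tens M N (b : 'cV[C]_M) (A : 'M[C]_M) (B : 'M[C]_N) :
  slotA N b ^t* *m (A *t B) *m slotA N b = (b ^t* *m A *m b) 0 0 *: B.
Proof.
apply/matrixP => k l; rewrite slotA_congrE !mxE mulr_suml exchange_big.
apply: eq_bigr => j _; rewrite mxE !mulr_suml; apply: eq_bigr => i _.
by rewrite tensmxE adjE; ring.
Qed.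

Lemma slotB_tens M N (b : 'cV[C]_N) (A : 'M[C]_M) (B : 'M[C]_N) :
  slotB M b ^t* *m (A *t B) *m slotB M b = (b ^t* *m B *m b) 0 0 *: A.
Proof.
apply/matrixP => k l; rewrite slotB_congrE !mxE mulr_suml exchange_big.
apply: eq_bigr => j _; rewrite mxE !mulr_suml; apply: eq_bigr => i _.
by rewrite tensmxE adjE; ring.
Qed.

(* Kraus operators of rank one: [X |-> \sum_k (psi k e k^* ) X (psi k e k^* )^*]. *)
Definition measure_prepare (T : finType) a b (e : T -> 'cV[C]_a) (psi : T -> 'cV[C]_b)
    (f : 'M[C]_a -> 'M[C]_b) : Prop :=
  [/\ \sum_k proj (e k) = 1%:M, forall k, ((psi k) ^t* *m psi k) 0 0 = 1 &
      forall X, f X = \sum_k ((e k) ^t* *m X *m e k) 0 0 *: proj (psi k)].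

Lemma mp_linear (T : finType) a b (e : T -> 'cV[C]_a) (psi : T -> 'cV[C]_b) f :
  measure_prepare e psi f -> linear f.
Proof.
case=> _ _ fE c A B; rewrite !fE scaler_sumr -big_split; apply: eq_bigr => k _ /=.
by rewrite mulmxDr mulmxDl -scalemxAr -scalemxAl mxE mxE scalerDl scalerA.
Qed.

Lemma form_tr a (X : 'M[C]_a) (v : 'cV[C]_a) :
  (v ^t* *m X *m v) 0 0 = \tr (X *m proj v).
Proof. by rewrite /proj mulmxA mxtrace_mulC mulmxA /mxtrace big_ord1. Qed.

Lemma mp_tr (T : finType) a b (e : T -> 'cV[C]_a) (psi : T -> 'cV[C]_b) f X :
  measure_prepare e psi f -> \tr (f X) = \tr X.
Proof.
case=> e1 psi1 ->; rewrite raddf_sum -[in RHS](mulmx1 X) -e1 mulmx_sumr raddf_sum.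
by apply: eq_bigr => k _; rewrite /= mxtraceZ tr_proj psi1 mulr1 form_tr.
Qed.

Lemma tens_map_mpl (T : finType) a b a' b' (e : T -> 'cV[C]_a) (psi : T -> 'cV[C]_b)
    f (g : 'M[C]_a' -> 'M[C]_b') X :
  measure_prepare e psi f -> linear g ->
  tens_map f g X = \sum_k proj (psi k) *t g (slotA a' (e k) ^t* *m X *m slotA a' (e k)).
Proof.
move=> fmp gl; have fl := mp_linear fmp; case: fmp => _ _ fE.
pose F k (Y : 'M[C]_(a * a')) :=
  proj (psi k) *t g (slotA a' (e k) ^t* *m Y *m slotA a' (e k)).
have Fs k (I : finType) (H : I -> 'M[C]_(a * a')) : F k (\sum_i H i) = \sum_i F k (H i).
  by rewrite /F mulmx_sumr mulmx_suml lin_sum // tens_sumr.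
have FZ k c Y : F k (c *: Y) = c *: F k Y.
  by rewrite /F -scalemxAr -scalemxAl linZ // tensZr.
rewrite -[RHS]/(\sum_k F k X) [in RHS](mx_tens_sum X).
under [RHS]eq_bigr do rewrite Fs.
rewrite [RHS]exchange_big; apply: eq_bigr => i _; under [RHS]eq_bigr do rewrite Fs.
rewrite [RHS]exchange_big; apply: eq_bigr => j _; under [RHS]eq_bigr do rewrite Fs.
rewrite [RHS]exchange_big; apply: eq_bigr => k _; under [RHS]eq_bigr do rewrite Fs.
rewrite [RHS]exchange_big; apply: eq_bigr => l _.
rewrite fE tens_suml scaler_sumr; apply: eq_bigr => m _.
by rewrite FZ /F slotA_tens (linZ _ _ gl) tensZr tensZl.
Qed.

Lemma tens_map_mpr (T : finType) a b a' b' (e : T -> 'cV[C]_a) (psi : T -> 'cV[C]_b)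
    f (g : 'M[C]_a' -> 'M[C]_b') X :
  measure_prepare e psi f -> linear g ->
  tens_map g f X = \sum_k g (slotB a' (e k) ^t* *m X *m slotB a' (e k)) *t proj (psi k).
Proof.
move=> fmp gl; have fl := mp_linear fmp; case: fmp => _ _ fE.
pose F k (Y : 'M[C]_(a' * a)) :=
  g (slotB a' (e k) ^t* *m Y *m slotB a' (e k)) *t proj (psi k).
have Fs k (I : finType) (H : I -> 'M[C]_(a' * a)) : F k (\sum_i H i) = \sum_i F k (H i).
  by rewrite /F mulmx_sumr mulmx_suml lin_sum // tens_suml.
have FZ k c Y : F k (c *: Y) = c *: F k Y.
  by rewrite /F -scalemxAr -scalemxAl linZ // tensZl.
rewrite -[RHS]/(\sum_k F k X) [in RHS](mx_tens_sum X).
under [RHS]eq_bigr do rewrite Fs.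
rewrite [RHS]exchange_big; apply: eq_bigr => i _; under [RHS]eq_bigr do rewrite Fs.
rewrite [RHS]exchange_big; apply: eq_bigr => j _; under [RHS]eq_bigr do rewrite Fs.
rewrite [RHS]exchange_big; apply: eq_bigr => k _; under [RHS]eq_bigr do rewrite Fs.
rewrite [RHS]exchange_big; apply: eq_bigr => l _.
rewrite fE tens_sumr scaler_sumr; apply: eq_bigr => m _.
by rewrite FZ /F slotB_tens (linZ _ _ gl) tensZl tensZr.
Qed.

(** A resolution of the identity by vectors that may be neither normalized nor orthogonal computes
    traces just as an orthonormal basis does. *)
Lemma resolution_sum (T : finType) N (e : T -> 'cV[C]_N) (Z : 'I_N -> 'I_N -> C) :
  \sum_k proj (e k) = 1%:M ->
  \sum_k \sum_i \sum_j (e k i 0)^* * Z i j * e k j 0 = \sum_i Z i i.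
Proof.
move=> e1; rewrite exchange_big; apply: eq_bigr => i _ /=.
rewrite exchange_big -(sum_delta (fun j => Z i j) i); apply: eq_bigr => j _ /=.
have /matrixP/(_ j i) := e1; rewrite summxE mxE => <-.
by rewrite mulr_sumr; apply: eq_bigr => k _; rewrite projE; ring.
Qed.

Lemma slotA_resolution (T : finType) M N (e : T -> 'cV[C]_M) (X : 'M[C]_(M * N)) :
  \sum_k proj (e k) = 1%:M ->
  \sum_k slotA N (e k) ^t* *m X *m slotA N (e k) = ptraceA X.
Proof.
move=> e1; apply/matrixP => i j; rewrite summxE mxE.
under eq_bigr do rewrite slotA_congrE.
exact: (resolution_sum (fun i' j' => X (mxtens_index (i', i)) (mxtens_index (j', j)))).
Qed.

Lemma slotB_resolution (T : finType) M N (e : T -> 'cV[C]_N) (X : 'M[C]_(M * N)) :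
  \sum_k proj (e k) = 1%:M ->
  \sum_k slotB M (e k) ^t* *m X *m slotB M (e k) = ptraceB X.
Proof.
move=> e1; apply/matrixP => i j; rewrite summxE mxE.
under eq_bigr do rewrite slotB_congrE.
exact: (resolution_sum (fun i' j' => X (mxtens_index (i, i')) (mxtens_index (j, j')))).
Qed.

Lemma linear_id N : linear (@id 'M[C]_N). Proof. by []. Qed.

Lemma mp_channel (T : finType) a b (e : T -> 'cV[C]_a) (psi : T -> 'cV[C]_b) f :
  measure_prepare e psi f -> is_channel f.
Proof.
move=> fmp; split; [exact: mp_linear fmp|by move=> X; exact: mp_tr fmp|].
move=> k X Xpsd; rewrite (tens_map_mpr _ fmp (@linear_id k)).
apply: psd_sum => m; apply: psd_tens; last exact: psd_proj.
exact: psd_congr.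
Qed.

(** Outcome [m] prepares [psi m] and leaves the reference system in the unnormalized state [Z m].
    The traces of the [Z m] are the weights of the separable decomposition; they sum to one because
    the [e m] resolve the identity. *)
Lemma mp_entanglement_breaking (T : finType) a b (e : T -> 'cV[C]_a)
    (psi : T -> 'cV[C]_b) f :
  measure_prepare e psi f -> entanglement_breaking f.
Proof.
move=> fmp; split; first exact: mp_channel fmp.
move=> k X Xst; have k0 : (0 < k)%N by have := state_dim_gt0 Xst; rewrite muln_gt0 => /andP[].
rewrite (tens_map_mpr _ fmp (@linear_id k)).
pose Z m := slotB k (e m) ^t* *m X *m slotB k (e m).
have Zpsd m : psd (Z m) by apply: psd_congr; case: Xst.
have /choice[alpha aP] m := psd_normalize k0 (Zpsd m).
have [e1 psi1 _] := fmp.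
exists #|T|, (fun r => complex.Re (\tr (Z (enum_val r)))), (fun r => alpha (enum_val r)),
  (fun r => proj (psi (enum_val r))); split.
- split; first by move=> r; rewrite -ler0c -ge0_Re psd_tr_ge0.
  rewrite (sum_enum_val (fun m => complex.Re (\tr (Z m)))) -Re_sum -raddf_sum /=.
  by rewrite slotB_resolution // tr_ptraceB (proj2 Xst).
- by move=> r; exact: (aP _).1.
- by move=> r; exact: is_state_proj.
- rewrite (sum_enum_val (fun m => (complex.Re (\tr (Z m)))%:C *: (alpha m *t proj (psi m)))).
  apply: eq_bigr => m _; rewrite -tensZl -(aP m).2 //.
Qed.

Lemma mp_tens (T T' : finType) a b a' b' (e : T -> 'cV[C]_a) (psi : T -> 'cV[C]_b) f
    (e' : T' -> 'cV[C]_a') (psi' : T' -> 'cV[C]_b') g :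
  measure_prepare e psi f -> measure_prepare e' psi' g ->
  measure_prepare (fun k : T * T' => tensv (e k.1) (e' k.2))
    (fun k => tensv (psi k.1) (psi' k.2)) (tens_map f g).
Proof.
move=> fmp gmp; have [e1 psi1 _] := fmp; have [e1' psi1' gE] := gmp; split.
- rewrite -(pair_bigA _ (fun k l => proj (tensv (e k) (e' l)))) /= -tens1 -e1 -e1'.
  rewrite tens_suml; apply: eq_bigr => k _; rewrite tens_sumr; apply: eq_bigr => l _.
  by rewrite proj_tens.
- by move=> k; rewrite tensv_form psi1 psi1' mulr1.
- move=> X; rewrite (tens_map_mpl _ fmp (mp_linear gmp)).
  rewrite -(pair_bigA _ (fun k l => ((tensv (e k) (e' l)) ^t* *m X *m tensv (e k) (e' l)) 0 0
    *: proj (tensv (psi k) (psi' l)))) /=.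
  apply: eq_bigr => k _; rewrite gE tens_sumr; apply: eq_bigr => l _.
  by rewrite tensZr proj_tens -(slotA_mulv (e k)) adjM !mulmxA.
Qed.

Lemma mp_id1 : measure_prepare (fun _ : unit => 1%:M : 'cV[C]_1)
  (fun _ => 1%:M) (@id 'M[C]_1).
Proof.
have u1 : (1%:M : 'cV[C]_1) ^t* = 1%:M by rewrite trmx1 map_mx1.
split.
- by rewrite big_const card_unit /= addr0 /proj u1 mulmx1.
- by move=> _; rewrite u1 mulmx1 mxE.
- move=> X; rewrite big_const card_unit /= addr0 /proj u1 mulmx1 mul1mx mulmx1.
  by rewrite scalemx1 [LHS]mx11_scalar.
Qed.

Lemma mp_tens_pow (T : finType) a b (e : T -> 'cV[C]_a) (psi : T -> 'cV[C]_b) f m :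
  measure_prepare e psi f ->
  exists (T' : finType) e' psi', @measure_prepare T' _ _ e' psi' (@tens_pow R a b f m).
Proof.
move=> fmp; elim: m => [|m [T' [e' [psi' IH]]]].
  by exists unit, (fun=> 1%:M), (fun=> 1%:M); exact: mp_id1.
exists (T * T')%type, (fun k => tensv (e k.1) (e' k.2)),
  (fun k => tensv (psi k.1) (psi' k.2)).
exact: mp_tens.
Qed.

(** Complete positivity with a one-dimensional reference; compressing by [slotA b 1%:M] strips the
    trivial factor. *)
Lemma channel_psd a b (f : 'M[C]_a -> 'M[C]_b) A : is_channel f -> psd A -> psd (f A).
Proof.
move=> [fl _ fcp] Apsd.
have one : psd (1%:M : 'M[C]_1).
  move=> v; rewrite mulmx1 form_norm ler0c.
  by apply: sumr_ge0 => i _; exact: sqn_ge0.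
have := fcp _ _ (psd_tens one Apsd).
rewrite tens_map_tens // => /(psd_congr (slotA b (1%:M : 'cV[C]_1))).
by rewrite slotA_tens trmx1 map_mx1 !mulmx1 mxE scale1r.
Qed.

Lemma channel_state a b (f : 'M[C]_a -> 'M[C]_b) A :
  is_channel f -> is_state A -> is_state (f A).
Proof.
move=> fch [Apsd Atr]; split; first exact: channel_psd.
by case: fch => _ -> _.
Qed.

End MeasurePrepare.

(** * Holevo information *)

Section Holevo.
Variable R : realType.
Local Notation C := R[i].

(* Complete positivity of [tens_map f g] is not needed for the Holevo bounds. *)
Definition state_map a b (f : 'M[C]_a -> 'M[C]_b) : Prop :=
  linear f /\ forall A, is_state A -> is_state (f A).

Lemma channel_state_map a b (f : 'M[C]_a -> 'M[C]_b) : is_channel f -> state_map f.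
Proof. by move=> fch; split=> [|A]; [case: fch|exact: channel_state]. Qed.

(** [holevo_quantity] over an arbitrary finite index type, so that ensembles may be labelled by
    pairs. *)
Definition holevo_diff (T : finType) a b (f : 'M[C]_a -> 'M[C]_b) (p : T -> R)
    (rho : T -> 'M[C]_a) : R :=
  entropy (f (\sum_k (p k)%:C *: rho k)) - \sum_k p k * entropy (f (rho k)).

Lemma holevo_diff_le_chi (T : finType) a b (f : 'M[C]_a -> 'M[C]_b) (p : T -> R)
    (rho : T -> 'M[C]_a) :
  state_map f -> (forall k, 0 <= p k) -> \sum_k p k = 1 ->
  (forall k, is_state (rho k)) -> holevo_diff f p rho <= holevo_chi f.
Proof.
move=> [fl fs] p0 p1 rhos; apply: ub_le_sup.
  (* Boundedness is what makes [sup] an upper bound: output entropies are nonnegative and at most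
     [log2 b]. *)
  exists (log2 b%:R) => _ [r [q [tau [[q0 q1] taus ->]]]].
  rewrite lerBlDr; apply: ler_wpDr.
    by apply: sumr_ge0 => k _; rewrite mulr_ge0 // entropy_ge0 //; exact: fs.
  by apply: entropy_le_log2; apply: fs; exact: is_state_mix.
exists #|T|, (fun k => p (enum_val k)), (fun k => rho (enum_val k)); split => //.
  by split=> //; rewrite (sum_enum_val p).
rewrite /holevo_quantity /holevo_diff.
by rewrite (sum_enum_val (fun k => (p k)%:C *: rho k))
  (sum_enum_val (fun k => p k * entropy (f (rho k)))).
Qed.

Lemma holevo_chi_le a b (f : 'M[C]_a -> 'M[C]_b) c : (0 < a)%N ->
  (forall r (p : 'I_r -> R) rho, (forall k, 0 <= p k) -> \sum_k p k = 1 ->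
     (forall k, is_state (rho k)) -> holevo_diff f p rho <= c) ->
  holevo_chi f <= c.
Proof.
move=> a0 H; apply: ge_sup; last first.
  by move=> _ [r [p [rho [[p0 p1] rhos ->]]]]; exact: H.
pose rho0 : 'M[C]_a := proj (delta_mx (Ordinal a0) 0).
exists (holevo_quantity f (fun _ : 'I_1 => 1) (fun=> rho0)).
exists 1, (fun=> 1), (fun=> rho0); split => //.
  by split=> [_|]; [exact: ler01|rewrite big_ord1].
by move=> _; exact: is_state_delta.
Qed.

Lemma tens_map_linear a b a' b' (f : 'M[C]_a -> 'M[C]_b) (g : 'M[C]_a' -> 'M[C]_b') :
  linear (tens_map f g).
Proof.
move=> c A B; rewrite /tens_map scaler_sumr -big_split; apply: eq_bigr => i _ /=.
rewrite scaler_sumr -big_split; apply: eq_bigr => j _ /=.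
rewrite scaler_sumr -big_split; apply: eq_bigr => k _ /=.
rewrite scaler_sumr -big_split; apply: eq_bigr => l _ /=.
by rewrite !mxE scalerDl scalerA.
Qed.

(** Product ensembles: on them entropies add, and so do the Holevo quantities. *)
Lemma holevo_chi_superadditive a b a' b' (f : 'M[C]_a -> 'M[C]_b)
    (g : 'M[C]_a' -> 'M[C]_b') : (0 < a)%N -> (0 < a')%N ->
  state_map f -> state_map g -> state_map (tens_map f g) ->
  holevo_chi f + holevo_chi g <= holevo_chi (tens_map f g).
Proof.
move=> a0 a0' [fl fs] [gl gs] fgs; rewrite -lerBrDr; apply: holevo_chi_le => // r p rho p0 p1 rhos.
rewrite lerBrDl -lerBrDr; apply: holevo_chi_le => // r' p' rho' p0' p1' rhos'.
rewrite lerBrDr.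
pose P (k : 'I_r * 'I_r') := p k.1 * p' k.2.
pose Rho (k : 'I_r * 'I_r') := rho k.1 *t rho' k.2.
have P0 k : 0 <= P k by rewrite mulr_ge0.
have P1 : \sum_k P k = 1.
  rewrite -(pair_bigA _ (fun i j => p i * p' j)) /= -p1; apply: eq_bigr => i _.
  by rewrite -mulr_sumr p1' mulr1.
have Rhos k : is_state (Rho k) by exact: is_state_tens.
apply: le_trans (holevo_diff_le_chi fgs P0 P1 Rhos); rewrite /holevo_diff.
have -> : \sum_k (P k)%:C *: Rho k =
    (\sum_i (p i)%:C *: rho i) *t (\sum_j (p' j)%:C *: rho' j).
  rewrite -(pair_bigA _ (fun i j => (p i * p' j)%:C *: (rho i *t rho' j))) /= tens_suml.
  apply: eq_bigr => i _; rewrite tens_sumr; apply: eq_bigr => j _.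
  by rewrite tensZl tensZr scalerA -rmorphM.
rewrite tens_map_tens // entropy_tens; [|by apply: fs; exact: is_state_mix|
  by apply: gs; exact: is_state_mix].
rewrite -(pair_bigA _ (fun i j => p i * p' j * entropy (tens_map f g (rho i *t rho' j)))) /=.
have -> : \sum_i \sum_j p i * p' j * entropy (tens_map f g (rho i *t rho' j)) =
    \sum_i p i * entropy (f (rho i)) + \sum_j p' j * entropy (g (rho' j)); last by lra.
transitivity (\sum_i \sum_j (p' j * (p i * entropy (f (rho i))) +
                             p i * (p' j * entropy (g (rho' j))))).
  apply: eq_bigr => i _; apply: eq_bigr => j _.
  by rewrite tens_map_tens // entropy_tens; [ring|exact: fs|exact: gs].
under eq_bigr do rewrite big_split /= -mulr_suml -mulr_sumr p1' mul1r.
by rewrite big_split /= -mulr_suml p1 mul1r.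
Qed.

(** * Additivity when one factor is a measure-and-prepare map *)

Section Shor.
Variables (T : finType) (a b a' b' : nat).
Variables (e : T -> 'cV[C]_a) (psi : T -> 'cV[C]_b) (f : 'M[C]_a -> 'M[C]_b).
Variable g : 'M[C]_a' -> 'M[C]_b'.
Hypotheses (fmp : measure_prepare e psi f) (gch : is_channel g).

Let Z (X : 'M[C]_(a * a')) k := slotA a' (e k) ^t* *m X *m slotA a' (e k).

Lemma slotA_tr M N (v : 'cV[C]_M) (X : 'M[C]_(M * N)) :
  \tr (slotA N v ^t* *m X *m slotA N v) = (v ^t* *m ptraceB X *m v) 0 0.
Proof.
rewrite [RHS]mxE /mxtrace; under eq_bigr do rewrite slotA_congrE exchange_big.
rewrite exchange_big; apply: eq_bigr => j _ /=; rewrite mxE mulr_suml.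
rewrite exchange_big; apply: eq_bigr => i _ /=; rewrite adjE mxE mulr_sumr mulr_suml.
by [].
Qed.

Lemma ptraceB_tens_map_mp X : ptraceB (tens_map f g X) = f (ptraceB X).
Proof.
have [gl gtr _] := gch; case: (fmp) => _ _ ->.
rewrite (tens_map_mpl _ fmp gl) ptraceB_sum; apply: eq_bigr => k _.
by rewrite ptraceB_tens gtr slotA_tr.
Qed.

Lemma ptraceA_tens_map_mp X : ptraceA (tens_map f g X) = g (ptraceA X).
Proof.
have [gl gtr _] := gch; case: (fmp) => e1 psi1 _.
rewrite (tens_map_mpl _ fmp gl) ptraceA_sum -(slotA_resolution _ e1) lin_sum //.
by apply: eq_bigr => k _; rewrite ptraceA_tens tr_proj psi1 scale1r.
Qed.

Lemma state_map_tens_mp : state_map (tens_map f g).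
Proof.
split; first exact: tens_map_linear.
move=> A [Apsd Atr]; have [gl gtr _] := gch; split; last first.
  by rewrite -tr_ptraceA ptraceA_tens_map_mp gtr tr_ptraceA.
rewrite (tens_map_mpl _ fmp gl); apply: psd_sum => k; apply: psd_tens.
  exact: psd_proj.
by apply: channel_psd => //; exact: psd_congr.
Qed.

(* The outcome [k] of the measurement leaves the second system in the state
   [alpha k] with probability [q k]. *)
Lemma entropy_tens_map_mp X : is_state X ->
  exists (q : T -> R) (alpha : T -> 'M[C]_a'),
  [/\ forall k, 0 <= q k, \sum_k q k = 1, forall k, is_state (alpha k),
      \sum_k (q k)%:C *: alpha k = ptraceA X &
      entropy (f (ptraceB X)) + \sum_k q k * entropy (g (alpha k)) <=
      entropy (tens_map f g X)].
Proof.
move=> Xst; have a0 : (0 < a')%N.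
  by have := state_dim_gt0 Xst; rewrite muln_gt0 => /andP[].
have [gl gtr _] := gch; have [e1 psi1 _] := fmp.
have Zpsd k : psd (Z X k) by apply: psd_congr; case: Xst.
have /choice[alpha aP] k := psd_normalize a0 (Zpsd k).
pose q k := complex.Re (\tr (Z X k)).
have qa : \sum_k (q k)%:C *: alpha k = ptraceA X.
  by rewrite -(slotA_resolution _ e1); apply: eq_bigr => k _; rewrite -(aP k).2.
have q0 k : 0 <= q k by rewrite -ler0c -ge0_Re psd_tr_ge0.
have q1 : \sum_k q k = 1.
  rewrite -Re_sum -raddf_sum /= slotA_resolution // tr_ptraceA.
  by rewrite (proj2 Xst).
exists q, alpha; split => //; first by move=> k; exact: (aP k).1.
rewrite -ptraceB_tens_map_mp; apply: (entropy_cq_ge (psi := psi)) => //.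
  by move=> k; apply: channel_state => //; exact: (aP k).1.
rewrite (tens_map_mpl _ fmp gl); apply: eq_bigr => k _.
by rewrite -/(Z X k) [X in g X](aP k).2 (linZ _ _ gl) tensZr.
Qed.

Lemma holevo_chi_tens_mp : (0 < a)%N -> (0 < a')%N ->
  holevo_chi (tens_map f g) = holevo_chi f + holevo_chi g.
Proof.
move=> a0 a0'; have fs := channel_state_map (mp_channel fmp).
have gs := channel_state_map gch; have fgs := state_map_tens_mp.
apply/eqP; rewrite eq_le holevo_chi_superadditive // andbT.
apply: holevo_chi_le; first by rewrite muln_gt0 a0.
move=> r p rho p0 p1 rhos.
have /choice[q] k := entropy_tens_map_mp (rhos k).
move=> /choice[alpha H].
pose rbar := \sum_k (p k)%:C *: rho k.
have rst : is_state rbar by exact: is_state_mix.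
have rB : \sum_k (p k)%:C *: ptraceB (rho k) = ptraceB rbar.
  by rewrite ptraceB_sum; apply: eq_bigr => k _; rewrite ptraceBZ.
have rA : \sum_k (p k)%:C *: ptraceA (rho k) = ptraceA rbar.
  by rewrite ptraceA_sum; apply: eq_bigr => k _; rewrite ptraceAZ.
have chif := holevo_diff_le_chi fs p0 p1 (fun k => is_state_ptraceB (rhos k)).
(* The ensemble offered to [g] is labelled by the index of the joint input and the measurement
   outcome. *)
pose P (k : 'I_r * T) := p k.1 * q k.1 k.2.
pose al (k : 'I_r * T) := alpha k.1 k.2.
have P0 k : 0 <= P k by rewrite mulr_ge0 //; case: (H k.1).
have P1 : \sum_k P k = 1.
  rewrite -(pair_bigA _ (fun i j => p i * q i j)) /= -p1; apply: eq_bigr => i _.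
  by rewrite -mulr_sumr; have [_ -> _ _ _] := H i; rewrite mulr1.
have als k : is_state (al k) by have [_ _ h _ _] := H k.1; exact: h.
have chig := holevo_diff_le_chi gs P0 P1 als.
rewrite /holevo_diff rB in chif.
rewrite /holevo_diff in chig.
have PE : \sum_k (P k)%:C *: al k = ptraceA rbar.
  rewrite -rA -(pair_bigA _ (fun i j => (p i * q i j)%:C *: alpha i j)) /=.
  apply: eq_bigr => i _; have [_ _ _ <- _] := H i; rewrite scaler_sumr.
  by apply: eq_bigr => j _; rewrite scalerA -rmorphM.
have SE : \sum_k P k * entropy (g (al k)) =
    \sum_i p i * \sum_j q i j * entropy (g (alpha i j)).
  rewrite -(pair_bigA _ (fun i j => p i * q i j * entropy (g (alpha i j)))) /=.
  by apply: eq_bigr => i _; rewrite mulr_sumr; apply: eq_bigr => j _; rewrite mulrA.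
rewrite PE SE in chig.
(* Subadditivity bounds the entropy of the average output from above, [low] bounds the subtracted
   average from below, and the difference is the sum of the two Holevo quantities in [chif] and
   [chig]. *)
have sub := entropy_subadditive (fgs.2 _ rst).
rewrite ptraceB_tens_map_mp ptraceA_tens_map_mp in sub.
have low : \sum_i p i * entropy (f (ptraceB (rho i))) +
    \sum_i p i * \sum_j q i j * entropy (g (alpha i j)) <=
    \sum_i p i * entropy (tens_map f g (rho i)).
  rewrite -big_split; apply: ler_sum => i _ /=; rewrite -mulrDr ler_wpM2l //.
  by case: (H i).
rewrite /holevo_diff -/rbar; lra.
Qed.

End Shor.

Lemma holevo_chi_id1 : holevo_chi (@id 'M[C]_1) = 0.
Proof.
have S0 (A : 'M[C]_1) : is_state A -> entropy A = 0.
  move=> As; apply/eqP; rewrite eq_le entropy_ge0 // andbT.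
  by rewrite (le_trans (entropy_le_log2 As)) // /log2 ln1 mul0r.
apply/eqP; rewrite eq_le; apply/andP; split.
  apply: holevo_chi_le => // r p rho p0 p1 rhos; rewrite /holevo_diff.
  rewrite S0 ?sub0r ?oppr_le0; last exact: is_state_mix.
  by apply: sumr_ge0 => k _; rewrite mulr_ge0 // entropy_ge0.
have one : is_state (proj (delta_mx 0 0) : 'M[C]_1) by exact: is_state_delta.
have sm : state_map (@id 'M[C]_1) by split => //; exact: linear_id.
have := @holevo_diff_le_chi unit _ _ _ (fun=> 1) (fun=> proj (delta_mx 0 0)) sm.
move=> /(_ (fun=> ler01)); rewrite big_const card_unit /= addr0 => /(_ erefl (fun=> one)).
rewrite /holevo_diff !big_const card_unit /= !addr0 S0; last by rewrite rmorph1 scale1r.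
by rewrite S0 // mulr0 subrr.
Qed.

Lemma exp_dim_gt0 a m : (0 < a)%N -> (0 < exp_dim a m)%N.
Proof. by move=> a0; elim: m => //= m IH; rewrite muln_gt0 a0. Qed.

Lemma holevo_chi_tens_pow (T : finType) a b (e : T -> 'cV[C]_a) (psi : T -> 'cV[C]_b)
    f m : (0 < a)%N -> measure_prepare e psi f ->
  holevo_chi (@tens_pow R a b f m) = m%:R * holevo_chi f.
Proof.
move=> a0 fmp; elim: m => [|m IH]; first by rewrite mul0r; exact: holevo_chi_id1.
have [T' [e' [psi' mmp]]] := mp_tens_pow m fmp.
rewrite -[LHS]/(holevo_chi (tens_map f (@tens_pow R a b f m))).
rewrite (holevo_chi_tens_mp fmp (mp_channel mmp)) ?exp_dim_gt0 // IH.
by rewrite -natr1; ring.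
Qed.

Lemma holevo_rate_cvg (T : finType) a b (e : T -> 'cV[C]_a) (psi : T -> 'cV[C]_b) f :
  (0 < a)%N -> measure_prepare e psi f ->
  holevo_rate f @ \oo --> holevo_chi f.
Proof.
(* The rate is constant only from [m = 1] on; at [m = 0] the factor [0^-1 = 0] makes it zero. *)
move=> a0 fmp; apply: cvg_near_cst; exists 1%N => // m /= m0.
rewrite /holevo_rate (holevo_chi_tens_pow _ a0 fmp) mulrA mulVf ?mul1r //.
by rewrite pnatr_eq0 -lt0n.
Qed.

End Holevo.

(** * Weyl operators *)

Section RootsOfUnity.
Variables (R : realType) (d : nat).
Hypotheses (d_pr : prime d) (d_odd : odd d).
Local Notation C := R[i].
Local Notation w := (@omega_pow R d).

Lemma demoivre (t : R) k : (cos t +i* sin t) ^+ k = cos (t *+ k) +i* sin (t *+ k) :> C.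
Proof.
elim: k => [|k IH]; first by rewrite mulr0n cos0 sin0.
rewrite exprS IH mulrS cosD sinD; apply/eqP; rewrite eq_complex /=.
by rewrite eqxx addrC eqxx.
Qed.

Lemma omega_expd : omega R d ^+ d = 1.
Proof.
have dn0 : d%:R != 0 :> R by rewrite pnatr_eq0 -lt0n prime_gt0.
have E : 2 * pi / d%:R *+ d = pi *+ 2 :> R.
  by rewrite -[_ *+ d]mulr_natr divfK // mulrC mulr_natr.
by rewrite /omega demoivre E cos2pi sin2pi.
Qed.

(** For [d >= 3] the angle [2 pi / d] lies strictly between [0] and [pi], so the imaginary part is
    positive. *)
Lemma omega_neq1 : omega R d != 1.
Proof.
have d3 : (2 < d)%N by case: d d_pr d_odd => [|[|[|]]].
rewrite eq_complex negb_and; apply/orP; right; rewrite /= gt_eqF //.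
have d0 : 0 < d%:R :> R by rewrite ltr0n prime_gt0.
apply: sin_gt0_pi; rewrite divr_gt0 ?mulr_gt0 ?pi_gt0 //= ltr_pdivrMr //.
by rewrite mulrC ltr_pM2l ?pi_gt0 // ltr_nat.
Qed.

Lemma omega_powD x y : w (x + y) = w x * w y.
Proof.
rewrite /omega_pow -exprD -[RHS](expr_mod _ omega_expd).
(* Addition in ['F_d] reduces modulo the modulus built into the type, which equals [d] because [d]
   is prime. *)
congr (_ ^+ _); rewrite /=; congr (_ %% _)%N; exact: Fp_cast.
Qed.

Lemma omega_pow0 : w 0 = 1. Proof. by []. Qed.

Lemma omega_pow1 : w 1 = omega R d.
Proof. by rewrite /omega_pow -[RHS]expr1; congr (_ ^+ _). Qed.

Lemma omega_powN x : w (- x) = (w x)^*.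
Proof.
have om : omega R d * (omega R d)^* = 1.
  by rewrite -sqnE /sqn /= cos2Dsin2.
have wx : w x * (w x)^* = 1.
  by rewrite /omega_pow rmorphXn -exprMn om expr1n.
have wn0 : w x != 0 by apply: contra_eq_neq wx => ->; rewrite mul0r eq_sym oner_eq0.
by apply: (mulfI wn0); rewrite wx -omega_powD subrr.
Qed.

Lemma omega_pow_sum (I : finType) (F : I -> 'F_d) :
  w (\sum_i F i) = \prod_i w (F i).
Proof. by rewrite (big_morph w omega_powD omega_pow0). Qed.

(** The shift permutes the summands and multiplies the sum by [c != 1]. *)
Lemma sum_character0 (V : finType) (chi : V -> C) (shift : V -> V) (c : C) :
  injective shift -> (forall v, chi (shift v) = c * chi v) -> c != 1 ->
  \sum_v chi v = 0.
Proof.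
move=> shiftI chiD c1; have : \sum_v chi v = c * \sum_v chi v.
  by rewrite mulr_sumr (reindex_inj shiftI); apply: eq_bigr => v _.
move/eqP; rewrite -subr_eq0 -[X in X - _]mul1r -mulrBl mulf_eq0 subr_eq0 eq_sym.
by rewrite (negPf c1) => /eqP.
Qed.

End RootsOfUnity.

(** * Matrix entries indexed by finite types instead of ordinals *)

Section Entries.
Variable R : realType.
Local Notation C := R[i].

Definition ent (S T : finType) (A : 'M[C]_(#|S|, #|T|)) x y :=
  A (enum_rank x) (enum_rank y).

Lemma sum_enum_rank (V : nmodType) (T : finType) (F : 'I_#|T| -> V) :
  \sum_k F k = \sum_x F (enum_rank x).
Proof.
by rewrite -(sum_enum_val (fun x => F (enum_rank x))); under [RHS]eq_bigr do rewrite enum_valK.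
Qed.

Lemma entP (T : finType) (A B : 'M[C]_#|T|) : (forall x y, ent A x y = ent B x y) -> A = B.
Proof.
move=> AB; apply/matrixP => i j; have := AB (enum_val i) (enum_val j).
by rewrite /ent !enum_valK.
Qed.

Lemma entM (T : finType) (A B : 'M[C]_#|T|) x y :
  ent (A *m B) x y = \sum_z ent A x z * ent B z y.
Proof. by rewrite /ent mxE sum_enum_rank. Qed.

Lemma ent_tr (T : finType) (A : 'M[C]_#|T|) : \tr A = \sum_x ent A x x.
Proof. by rewrite /mxtrace sum_enum_rank. Qed.

Lemma entZ (T : finType) a (A : 'M[C]_#|T|) x y : ent (a *: A) x y = a * ent A x y.
Proof. by rewrite /ent mxE. Qed.

Lemma ent_sum (T I : finType) (P : pred I) (F : I -> 'M[C]_#|T|) x y :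
  ent (\sum_(i | P i) F i) x y = \sum_(i | P i) ent (F i) x y.
Proof. by rewrite /ent summxE. Qed.

Lemma ent_adj (T : finType) (A : 'M[C]_#|T|) x y : ent (A ^t*) x y = (ent A y x)^*.
Proof. by rewrite /ent adjE. Qed.

Lemma ent1 (T : finType) x y : ent (1%:M : 'M[C]_#|T|) x y = (x == y)%:R.
Proof. by rewrite /ent mxE (inj_eq enum_rank_inj). Qed.

Lemma ent_ketbra (T : finType) (x y a b : T) :
  ent (ket R x *m bra R y) a b = ((a == x) && (b == y))%:R.
Proof.
rewrite /ent /bra /ket trmx_delta map_delta_mx mul_delta_mx mxE.
by rewrite !(inj_eq enum_rank_inj).
Qed.

End Entries.

Section WeylOperators.
Variables (R : realType) (d n : nat).
Hypotheses (d_pr : prime d) (d_odd : odd d).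
Local Notation C := R[i].
Local Notation w := (@omega_pow R d).
Local Notation Zdn := 'rV['F_d]_n.
Local Notation W := (@weyl R d n).

Lemma ent_Xop x y : ent (Xop R d) x y = (x == y + 1)%:R.
Proof.
rewrite ent_sum (bigD1 y) //= ent_ketbra eqxx andbT big1 ?addr0 // => k ky.
by rewrite ent_ketbra [y == k]eq_sym (negPf ky) andbF.
Qed.

Lemma ent_Zop x y : ent (Zop R d) x y = (x == y)%:R * w x.
Proof.
rewrite ent_sum (bigD1 y) //= entZ ent_ketbra eqxx andbT big1 ?addr0 => [|k ky].
  by rewrite mulrC; case: eqP => [->|]; rewrite ?mul0r.
by rewrite entZ ent_ketbra [y == k]eq_sym (negPf ky) andbF mulr0.
Qed.

Lemma ent_Xop_exp k x y : ent (Xop R d ^+ k) x y = (x == y + k%:R)%:R.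
Proof.
elim: k x y => [|k IH] x y; first by rewrite addr0 ent1.
rewrite exprS entM (bigD1 (y + k%:R)) //= IH eqxx mulr1 big1 ?addr0 => [|z zn].
  by rewrite ent_Xop -natr1 addrA.
by rewrite IH (negPf zn) mulr0.
Qed.

Lemma ent_Zop_exp k x y : ent (Zop R d ^+ k) x y = (x == y)%:R * w (x *+ k).
Proof.
elim: k x y => [|k IH] x y; first by rewrite mulr0n omega_pow0 mulr1 ent1.
rewrite exprS entM (bigD1 y) //= IH eqxx mul1r big1 ?addr0 => [|z zn].
  rewrite ent_Zop mulrS omega_powD // -mulrA.
  by case: eqP => [->|]; rewrite ?mul0r.
by rewrite IH (negPf zn) mul0r mulr0.
Qed.

Lemma ent_tens_ops (A : 'I_n -> 'M[C]_#|'F_d|) (x y : Zdn) :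
  ent (tens_ops A) x y = \prod_i ent (A i) (x 0 i) (y 0 i).
Proof. by rewrite /ent mxE !enum_rankK. Qed.

Lemma prod_eqr (x y : Zdn) : \prod_i ((x 0 i == y 0 i)%:R : C) = (x == y)%:R.
Proof.
have [->|xy] := eqVneq x y; first by rewrite big1 // => i _; rewrite eqxx.
have [i xyi] : exists i, x 0 i != y 0 i.
  apply/existsP; rewrite -negb_forall; apply: contra_neqN xy => /forallP h.
  by apply/rowP => i; exact/eqP.
by rewrite (bigD1 i) //= (negPf xyi) mul0r.
Qed.

Lemma ent_Xpow (q x y : Zdn) : ent (Xpow R q) x y = (x == y + q)%:R.
Proof.
rewrite ent_tens_ops -prod_eqr; apply: eq_bigr => i _.
by rewrite ent_Xop_exp mxE natr_Zp.
Qed.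

Lemma ent_Zpow (p x y : Zdn) : ent (Zpow R p) x y = (x == y)%:R * w (dotp p x).
Proof.
rewrite ent_tens_ops -prod_eqr omega_pow_sum // -big_split; apply: eq_bigr => i _ /=.
by rewrite ent_Zop_exp -[X in w X]mulr_natl natr_Zp.
Qed.

Lemma ent_weyl (u : Zdn * Zdn) x y :
  ent (W u) x y = (x == y + u.2)%:R * w (dotp u.1 x - 2^-1 * dotp u.1 u.2).
Proof.
rewrite entZ entM (bigD1 x) //= ent_Zpow eqxx mul1r ent_Xpow big1 ?addr0 => [|z zn].
  by rewrite omega_powD //; ring.
by rewrite ent_Zpow eq_sym (negPf zn) !mul0r.
Qed.

Lemma dotpDl (p q r : Zdn) : dotp (p + q) r = dotp p r + dotp q r.
Proof. by rewrite -big_split; apply: eq_bigr => i _; rewrite mxE mulrDl. Qed.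

Lemma dotpC (p q : Zdn) : dotp p q = dotp q p.
Proof. by apply: eq_bigr => i _; rewrite mulrC. Qed.

Lemma dotpDr (p q r : Zdn) : dotp r (p + q) = dotp r p + dotp r q.
Proof. by rewrite !(dotpC r) dotpDl. Qed.

Lemma dotpZl a (p q : Zdn) : dotp (a *: p) q = a * dotp p q.
Proof. by rewrite mulr_sumr; apply: eq_bigr => i _; rewrite mxE mulrA. Qed.

Lemma dotpZr a (p q : Zdn) : dotp p (a *: q) = a * dotp p q.
Proof. by rewrite !(dotpC p) dotpZl. Qed.

Lemma dotpNl (p q : Zdn) : dotp (- p) q = - dotp p q.
Proof. by rewrite -scaleN1r dotpZl mulN1r. Qed.

Lemma dotpNr (p q : Zdn) : dotp p (- q) = - dotp p q.
Proof. by rewrite !(dotpC p) dotpNl. Qed.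

Lemma two_neq0 : 2 != 0 :> 'F_d.
Proof.
apply/eqP => /(congr1 (@nat_of_ord _)); rewrite val_Fp_nat //= => /eqP d2.
have := @dvdn_leq d 2 isT d2.
by case: d d_pr d_odd => [|[|[|]]].
Qed.

Lemma conj_natM k (z : C) : (k%:R * z)^* = k%:R * z^*.
Proof. by rewrite rmorphM rmorph_nat. Qed.

Lemma weyl_adj u : (W u) ^t* = W (- u).
Proof.
apply: entP => x y; rewrite ent_adj !ent_weyl conj_natM -omega_powN //=.
have [->|xy] := eqVneq y (x + u.2).
  rewrite addrK eqxx; congr (_ * w _).
  by rewrite !(dotpNl, dotpNr, dotpDr); field; exact: two_neq0.
by rewrite [x == _]eq_sym subr_eq (negPf xy) !mul0r.
Qed.

(** In general the product carries the phase [w (2^-1 * symp u v)], so on an isotropic subspace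
    [weyl] is a genuine group representation. *)
Lemma weylM u v : symp u v = 0 -> W u *m W v = W (u + v).
Proof.
rewrite /symp => /eqP; rewrite subr_eq0 => /eqP uv.
apply: entP => x y; rewrite entM ent_weyl (bigD1 (y + v.2)) //= big1 ?addr0; last first.
  by move=> z zn; rewrite [X in _ * X]ent_weyl (negPf zn) mul0r mulr0.
rewrite !ent_weyl eqxx mul1r /= addrAC -addrA.
have [->|] := eqVneq x (y + (u.2 + v.2)); last by rewrite !mul0r.
rewrite !mul1r -omega_powD //; congr w.
rewrite !(dotpDl, dotpDr) -uv.
by field; exact: two_neq0.
Qed.

Lemma weyl0 : W 0 = 1%:M.
Proof.
apply: entP => x y; rewrite ent_weyl ent1 /= addr0 -(scale0r 0) !dotpZl.
by rewrite !mul0r mulr0 subrr omega_pow0 mulr1.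
Qed.

End WeylOperators.

(** * Stabilizer projectors *)

Section RankOne.
Variable R : realType.
Local Notation C := R[i].

Lemma projZ N (a : C) (v : 'cV[C]_N) : proj (a *: v) = (a * a^*) *: proj v.
Proof. by apply/matrixP => i j; rewrite [RHS]mxE !projE !mxE rmorphM; ring. Qed.

(** A nonzero column of [P], normalized, is a unit vector [v] fixed by [P]. Then [P - proj v] is
    again a projector, of trace zero, hence zero. *)
Lemma projector_tr1 N (P : 'M[C]_N) : P ^t* = P -> P *m P = P -> \tr P = 1 ->
  exists v : 'cV[C]_N, (v ^t* *m v) 0 0 = 1 /\ P = proj v.
Proof.
move=> Ph PP Ptr.
have [j Pj] : exists j, P j j != 0.
  apply/existsP; rewrite -negb_forall; apply/negP => /forallP h.
  by move/eqP: Ptr; rewrite /mxtrace big1 ?(eq_sym 0) ?oner_eq0 // => i _; apply/eqP; exact: h.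
pose c := P *m delta_mx j 0 : 'cV[C]_N.
pose r := \sum_i sqn (c i 0).
have cc : (c ^t* *m c) 0 0 = r%:C by rewrite form_norm.
have cP : (c ^t* *m c) 0 0 = P j j.
  rewrite /c adjM Ph -mulmxA (mulmxA P P) PP trmx_delta map_delta_mx.
  by rewrite -rowE -colE !mxE.
have r0 : 0 < r.
  rewrite lt_def sumr_ge0 ?andbT; last by move=> i _; exact: sqn_ge0.
  by apply: contra_neq Pj => rz; rewrite -cP cc rz.
pose s : R := (Num.sqrt r)^-1.
have ss : s * s * r = 1.
  rewrite -{1}(sqr_sqrtr (ltW r0)) /s; field.
  by rewrite gt_eqF // sqrtr_gt0.
pose v := s%:C *: c; exists v.
have v1 : (v ^t* *m v) 0 0 = 1.
  rewrite /v adjZ conj_real -scalemxAl -scalemxAr scalerA mxE cc -!rmorphM /= ss.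
  by rewrite rmorph1.
split => //; apply/eqP; rewrite -subr_eq0; apply/eqP.
have Pv : P *m v = v by rewrite /v -scalemxAr /c mulmxA PP.
have vP : v ^t* *m P = v ^t* by rewrite -[X in _ *m X]Ph -adjM Pv.
have QQ : P - proj v = (P - proj v) ^t* *m 1%:M *m (P - proj v).
  rewrite mulmx1 adjB Ph /proj adjM trmxCK mulmxBr !mulmxBl PP -mulmxA vP mulmxA Pv.
  rewrite -!mulmxA (mulmxA (v ^t*) v) [v ^t* *m v]mx11_scalar v1 mul1mx.
  by rewrite subrr subr0.
apply: psd_tr0.
  rewrite QQ; apply: psd_congr => x; rewrite mulmx1 form_norm ler0c.
  by apply: sumr_ge0 => i _; exact: sqn_ge0.
by rewrite raddfB /= Ptr tr_proj v1 subrr.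
Qed.

(** The mixing weight is absorbed into the measurement: its square root scales the vectors [e k l],
    and the index [k] becomes part of the outcome. *)
Lemma mp_mix (T T' : finType) a b (p : T -> R) (e : T -> T' -> 'cV[C]_a)
    (psi : T -> T' -> 'cV[C]_b) (f : T -> 'M[C]_a -> 'M[C]_b) f0 :
  (forall k, 0 <= p k) -> \sum_k p k = 1 ->
  (forall k, measure_prepare (e k) (psi k) (f k)) ->
  (forall X, f0 X = \sum_k (p k)%:C *: f k X) ->
  measure_prepare (fun k : T * T' => (Num.sqrt (p k.1))%:C *: e k.1 k.2)
    (fun k => psi k.1 k.2) f0.
Proof.
move=> p0 p1 fmp f0E.
have sp k : (Num.sqrt (p k))%:C * ((Num.sqrt (p k))%:C)^* = (p k)%:C :> C.
  by rewrite conj_real -rmorphM /= -expr2 sqr_sqrtr.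
split.
- rewrite -(pair_bigA _ (fun k l => proj ((Num.sqrt (p k))%:C *: e k l))) /=.
  transitivity (\sum_k (p k)%:C *: (1%:M : 'M[C]_a)).
    apply: eq_bigr => k _; have [<- _ _] := fmp k; rewrite scaler_sumr.
    by apply: eq_bigr => l _; rewrite projZ sp.
  by rewrite -scaler_suml -real_sum p1 rmorph1 scale1r.
- by move=> k; have [_ -> _] := fmp k.1.
- move=> X; rewrite f0E -(pair_bigA _ (fun k l => (((Num.sqrt (p k))%:C *: e k l) ^t* *m X *m
    ((Num.sqrt (p k))%:C *: e k l)) 0 0 *: proj (psi k l))) /=.
  apply: eq_bigr => k _; have [_ _ ->] := fmp k; rewrite scaler_sumr.
  apply: eq_bigr => l _; rewrite !form_tr projZ sp -scalemxAr mxtraceZ.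
  by rewrite scalerA.
Qed.

End RankOne.

(** * Symplectic orthogonality and dilated stabilizer projectors *)

Section Convolution.
Variables (R : realType) (d n : nat).
Hypotheses (d_pr : prime d) (d_odd : odd d).
Local Notation C := R[i].
Local Notation w := (@omega_pow R d).
Local Notation Zdn := 'rV['F_d]_n.
Local Notation Vn := (Zdn * Zdn)%type.
Local Notation W := (@weyl R d n).

Definition dilate (s t : 'F_d) (u : Vn) : Vn := (s *: u.1, t *: u.2).

Lemma dilateD s t u v : dilate s t (u + v) = dilate s t u + dilate s t v.
Proof. by rewrite /dilate /= !scalerDr. Qed.

Lemma dilateN s t u : dilate s t (- u) = - dilate s t u.
Proof. by rewrite /dilate /= !scalerN. Qed.

Lemma dilate0 s t : dilate s t 0 = 0.
Proof. by rewrite /dilate /= !scaler0. Qed.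

Lemma dilate_eq0 s t u : s != 0 -> t != 0 -> (dilate s t u == 0) = (u == 0).
Proof.
case: u => p q s0 t0.
by rewrite /dilate !xpair_eqE !scaler_eq0 (negPf s0) (negPf t0).
Qed.

Lemma symp_dilate s t u v : symp (dilate s t u) (dilate s t v) = s * t * symp u v.
Proof. by rewrite /symp /= !(dotpZl, dotpZr); ring. Qed.

Lemma sympDr (u v z : Vn) : symp z (u + v) = symp z u + symp z v.
Proof. by rewrite /symp /= !(dotpDl, dotpDr); ring. Qed.

Lemma sympDl (u v z : Vn) : symp (u + v) z = symp u z + symp v z.
Proof. by rewrite /symp /= !(dotpDl, dotpDr); ring. Qed.

Lemma sympNr (u z : Vn) : symp z (- u) = - symp z u.
Proof. by rewrite /symp /= !(dotpNl, dotpNr); ring. Qed.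

Lemma dotp_delta (p : Zdn) i : dotp p (delta_mx 0 i) = p 0 i.
Proof.
rewrite /dotp (bigD1 i) //= mxE !eqxx mulr1 big1 ?addr0 // => j ji.
by rewrite mxE (negPf ji) andbF mulr0.
Qed.

Lemma dotp0l (p : Zdn) : dotp 0 p = 0.
Proof. by rewrite -(scale0r 0) dotpZl mul0r. Qed.

Lemma dotp0r (p : Zdn) : dotp p 0 = 0.
Proof. by rewrite dotpC dotp0l. Qed.

Lemma symp_nondegenerate (u : Vn) : u != 0 -> exists v, symp v u = 1.
Proof.
case: u => p q; rewrite xpair_eqE negb_and => /orP[] /rV0Pn[i pi].
  exists (0, (- (p 0 i)^-1) *: delta_mx 0 i); rewrite /symp /= dotp0l dotpZr dotp_delta.
  by rewrite sub0r mulNr opprK mulVf.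
exists ((q 0 i)^-1 *: delta_mx 0 i, 0); rewrite /symp /= dotp0r dotpZl dotpC dotp_delta.
by rewrite subr0 mulVf.
Qed.

Lemma card_Vn : #|{: Vn}| = (d ^ n * d ^ n)%N.
Proof. by rewrite card_prod card_mx card_Fp // mul1n. Qed.

Lemma dn_neq0 : (d ^ n)%:R != 0 :> C.
Proof. by rewrite pnatr_eq0 -lt0n expn_gt0 prime_gt0. Qed.

(** Nondegeneracy gives [v0] with [symp v0 u = 1]; shifting by it multiplies the character sum by
    [omega]. *)
Lemma sum_symp (u : Vn) : \sum_v w (symp v u) = (u == 0)%:R * ((d ^ n)%:R * (d ^ n)%:R).
Proof.
have [->|u0] := eqVneq u 0.
  under eq_bigr do rewrite /symp /= dotp0r dotpC dotp0r subrr omega_pow0.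
  by rewrite sumr_const card_Vn mul1r natrM.
have [v0 v0u] := symp_nondegenerate u0.
rewrite mul0r; apply: (sum_character0 (shift := +%R v0) (c := w 1)) (addrI v0) _ _ => [v|].
  by rewrite sympDl v0u omega_powD.
by rewrite omega_pow1 omega_neq1.
Qed.

Lemma tr_weyl u : \tr (W u) = (u == 0)%:R * (d ^ n)%:R.
Proof.
rewrite ent_tr; case: u => p q; under eq_bigr do rewrite ent_weyl //= .
rewrite xpair_eqE.
have [->|q0] := eqVneq q 0; last first.
  rewrite andbF mul0r big1 // => x _.
  by rewrite -subr_eq0 opprD addrA subrr sub0r oppr_eq0 (negPf q0) mul0r.
under eq_bigr do rewrite addr0 eqxx mul1r dotp0r mulr0 subr0.
rewrite andbT; have [->|p0] := eqVneq p 0.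
  under eq_bigr do rewrite dotp0l omega_pow0.
  by rewrite sumr_const card_mx card_Fp // !mul1n mul1r.
have [i pi] := rV0Pn _ p0.
rewrite mul0r; pose x0 : Zdn := (p 0 i)^-1 *: delta_mx 0 i.
apply: (sum_character0 (shift := +%R x0) (c := w 1)) (addrI x0) _ _ => [x|].
  by rewrite dotpDr omega_powD // dotpZr dotp_delta mulVf.
by rewrite omega_pow1 omega_neq1.
Qed.

Section StabilizerProjector.
Variable M : {vspace Vn}.
Hypothesis Miso : max_isotropic M.

Lemma card_isotropic : #|M| = (d ^ n)%N.
Proof.
by case: Miso => dimM _; rewrite card_vspace card_Fp // dimM.
Qed.

(** The stabilizer operator of the image of [M] under [dilate s t], still indexed by [M], so that
    neither the image subspace nor its transported character has to be built. *)
Definition dilated_stab_op (nu : Vn -> C) (s t : 'F_d) : 'M[C]_#|{: Zdn}| :=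
  (d ^ n)%:R^-1 *: \sum_(u | u \in M) nu u *: W (dilate s t u).

Lemma character0 (nu : Vn -> C) : is_character M nu -> nu 0 = 1.
Proof.
move=> [nuM nu1]; have := nuM 0 0 (mem0v _) (mem0v _); rewrite addr0 => h.
have n0 : nu 0 != 0 by rewrite -normr_eq0 nu1 ?mem0v // oner_eq0.
by apply: (mulfI n0); rewrite mulr1 -h.
Qed.

Lemma characterN (nu : Vn -> C) u : is_character M nu -> u \in M -> nu (- u) = (nu u)^*.
Proof.
move=> nuch uM; have [nuM nu1] := nuch.
have n0 : nu u != 0 by rewrite -normr_eq0 nu1 // oner_eq0.
apply: (mulfI n0); rewrite -nuM ?memvN // subrr character0 //.
by rewrite -normCK nu1 // expr1n.
Qed.

(** It is the average of a unitary representation of [M], since [dilate] scales [symp] and so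
    preserves isotropy: the reindexings [u -> - u] and [v -> u + v] make it a projector. As
    [dilate s t] is injective, only [u = 0] contributes to the trace, which is therefore one. *)
Lemma dilated_stab_op_proj (nu : Vn -> C) (s t : 'F_d) : is_character M nu -> s != 0 -> t != 0 ->
  exists v, (v ^t* *m v) 0 0 = 1 /\ dilated_stab_op nu s t = proj v.
Proof.
move=> nuch s0 t0; have [nuM nu1] := nuch.
have oppI : injective (fun u : Vn => - u) by exact: oppr_inj.
apply: projector_tr1.
- rewrite adjZ fmorphV rmorph_nat; congr (_ *: _).
  transitivity (\sum_(u | u \in M) (nu u *: W (dilate s t u)) ^t*).
    apply/matrixP => x y; rewrite adjE !summxE rmorph_sum /=.
    by apply: eq_bigr => u _; rewrite adjE.
  rewrite (reindex_inj oppI); apply: eq_big => [u|u uM]; first exact: memvN.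
  rewrite memvN in uM; rewrite adjZ characterN // conjCK dilateN -weyl_adj //.
  by rewrite trmxCK.
- rewrite /dilated_stab_op -scalemxAl -scalemxAr scalerA.
  set S := \sum_(u | _) _.
  suff -> : S *m S = (d ^ n)%:R *: S by rewrite scalerA mulfVK ?dn_neq0.
  rewrite {1}/S mulmx_suml -card_isotropic -sumr_const scaler_suml.
  apply: eq_bigr => u uM; rewrite scale1r -scalemxAl mulmx_sumr scaler_sumr /S.
  have addI : injective (fun v : Vn => u + v) by exact: addrI.
  rewrite [RHS](reindex_inj addI); apply: eq_big => [v|v vM]; first by rewrite rpredDl.
  rewrite -scalemxAr scalerA nuM // dilateD weylM //.
  by rewrite symp_dilate (proj2 Miso) // mulr0.
- rewrite mxtraceZ raddf_sum /= (bigD1 (0 : Vn)) ?mem0v //= big1 ?addr0.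
    rewrite mxtraceZ character0 // mul1r dilate0 tr_weyl eqxx mul1r mulVf //.
    exact: dn_neq0.
  move=> u /andP[_ u0]; rewrite mxtraceZ tr_weyl dilate_eq0 // (negPf u0).
  by rewrite mul0r mulr0.
Qed.

End StabilizerProjector.

End Convolution.

(** * The convolutional channel *)

Lemma mx22_solve (F : fieldType) m (g00 g01 g10 g11 : F) (x y i j : 'rV[F]_m) :
  let N := (g00 * g11 - g01 * g10)^-1 in
  g00 * g11 - g01 * g10 != 0 ->
  (x == N * g11 *: i - N * g10 *: j) && (y == - (N * g01) *: i + N * g00 *: j) =
  (i == g00 *: x + g10 *: y) && (j == g01 *: x + g11 *: y).
Proof.
move=> N D0; rewrite /N.
by apply/andP/andP => -[/eqP -> /eqP ->]; split; apply/eqP/rowP => k;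
  rewrite !mxE; field.
Qed.

Section ConvolutionChannel.
Variables (R : realType) (d n : nat).
Hypotheses (d_pr : prime d) (d_odd : odd d).
Variable G : 'M['F_d]_2.
Hypothesis Gpos : positive_convolution G.
Local Notation C := R[i].
Local Notation w := (@omega_pow R d).
Local Notation Zdn := 'rV['F_d]_n.
Local Notation Vn := (Zdn * Zdn)%type.
Local Notation W := (@weyl R d n).
Local Notation qudits := #|{: Zdn}|.
Local Notation Mq := 'M[C]_qudits.

Let g00 := G 0 0.
Let g01 := G 0 1.
Let g10 := G 1 0.
Let g11 := G 1 1.

Lemma conv_detE : \det G = g00 * g11 - g01 * g10.
Proof.
rewrite (expand_det_row _ 0) big_ord_recl big_ord1 /cofactor !det_mx11 !mxE.
have -> : lift 0 0 = 1 :> 'I_2 by exact: val_inj.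
have -> : lift 1 0 = 0 :> 'I_2 by exact: val_inj.
by rewrite /= expr0 expr1 mul1r mulN1r mulrN.
Qed.

Lemma conv_det_neq0 : \det G != 0.
Proof. by case: Gpos => Gu _; rewrite -unitfE -unitmxE. Qed.

Lemma conv_det_neq0' : g00 * g11 - g01 * g10 != 0.
Proof. by rewrite -conv_detE conv_det_neq0. Qed.

(** [conv_unitary] permutes the computational basis; this is the inverse permutation, given by the
    transpose of [G] without the determinant. Conjugation then merely relabels entries. *)
Definition conv_index (r : 'I_(qudits * qudits)) : 'I_(qudits * qudits) :=
  let x : Zdn := enum_val (mxtens_unindex r).1 in
  let y : Zdn := enum_val (mxtens_unindex r).2 in
  mxtens_index (enum_rank (g00 *: x + g10 *: y), enum_rank (g01 *: x + g11 *: y)).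

Lemma conv_indexE (x y : Zdn) :
  conv_index (mxtens_index (enum_rank x, enum_rank y)) =
  mxtens_index (enum_rank (g00 *: x + g10 *: y), enum_rank (g01 *: x + g11 *: y)).
Proof. by rewrite /conv_index mxtens_indexK /= !enum_rankK. Qed.

Lemma conv_unitaryE r t : conv_unitary R n G r t = (t == conv_index r)%:R.
Proof.
rewrite -[r]mxtens_unindexK -[t]mxtens_unindexK.
case: (mxtens_unindex r) (mxtens_unindex t) => [r1 r2] [t1 t2].
rewrite -[r1]enum_valK -[r2]enum_valK -[t1]enum_valK -[t2]enum_valK.
move: (enum_val r1) (enum_val r2) (enum_val t1) (enum_val t2) => x y i j.
rewrite conv_indexE (inj_eq (can_inj (@mxtens_indexK _ _))) xpair_eqE.
rewrite !(inj_eq enum_rank_inj) /conv_unitary summxE (bigD1 i) //= summxE (bigD1 j) //=.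
have E i' j' : (ket R ((\det G)^-1 * G 1 1 *: i' - (\det G)^-1 * G 1 0 *: j') *t
    ket R (- ((\det G)^-1 * G 0 1) *: i' + (\det G)^-1 * G 0 0 *: j') *m
    (bra R i' *t bra R j'))
    (mxtens_index (enum_rank x, enum_rank y)) (mxtens_index (enum_rank i, enum_rank j)) =
  ((x == (\det G)^-1 * G 1 1 *: i' - (\det G)^-1 * G 1 0 *: j') && (i == i'))%:R *
  ((y == - ((\det G)^-1 * G 0 1) *: i' + (\det G)^-1 * G 0 0 *: j') && (j == j'))%:R.
  by rewrite tensmx_mul tensmxE -!ent_ketbra.
rewrite E !eqxx !andbT big1 ?addr0; last first.
  by move=> j' jj; rewrite E [j == j']eq_sym (negPf jj) andbF mulr0.
rewrite big1 ?addr0; last first.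
  move=> i' ii; rewrite summxE big1 // => j' _.
  by rewrite E [i == i']eq_sym (negPf ii) andbF mul0r.
rewrite -natrM mulnb; congr ((nat_of_bool _)%:R).
by rewrite conv_detE mx22_solve // conv_det_neq0'.
Qed.

Lemma conv_unitary_congr (A : 'M[C]_(qudits * qudits)) r s :
  (conv_unitary R n G *m A *m (conv_unitary R n G) ^t*) r s =
  A (conv_index r) (conv_index s).
Proof.
rewrite mxE (bigD1 (conv_index s)) //= adjE conv_unitaryE eqxx rmorph1 mulr1.
rewrite [X in _ + X]big1 ?addr0; last first.
  by move=> t tn; rewrite adjE conv_unitaryE (negPf tn) rmorph0 mulr0.
rewrite mxE (bigD1 (conv_index r)) //= conv_unitaryE eqxx mul1r big1 ?addr0 //.
by move=> t tn; rewrite conv_unitaryE (negPf tn) mul0r.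
Qed.

Lemma ent_conv_channel (sigma rho : Mq) (a a' : Zdn) :
  ent (conv_channel G sigma rho) a a' =
  \sum_b ent rho (g00 *: a + g10 *: b) (g00 *: a' + g10 *: b) *
         ent sigma (g01 *: a + g11 *: b) (g01 *: a' + g11 *: b).
Proof.
rewrite /ent mxE sum_enum_rank; apply: eq_bigr => b _.
by rewrite conv_unitary_congr !conv_indexE tensmxE.
Qed.

Lemma conv_channel_sum (I : finType) (P : pred I) (c : I -> C) (sigma : I -> Mq) rho :
  conv_channel G (\sum_(k | P k) c k *: sigma k) rho =
  \sum_(k | P k) c k *: conv_channel G (sigma k) rho.
Proof.
apply: entP => a a'; rewrite ent_conv_channel ent_sum.
under [RHS]eq_bigr do rewrite entZ ent_conv_channel mulr_sumr.
rewrite [RHS]exchange_big; apply: eq_bigr => b _ /=.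
rewrite ent_sum mulr_sumr; apply: eq_bigr => k _.
by rewrite entZ mulrCA.
Qed.

(** Read off from [ent_conv_channel] with [sigma] the Weyl operator at [(p, q)]. Its support forces
    [g01 (a - a') = q], whence [t2], and [s2] for the column index of [rho]. Putting
    [b = (z - g00 a) / g10] in the phase [p . (g01 a + g11 b)] leaves [s1] as the coefficient of
    [p . z] and [t1] as that of [p . a]. *)
Let s1 := g11 / g10.
Let s2 := - (g00 / g01).
Let t1 := - (\det G / g10).
Let t2 := g01^-1.

Lemma conv_channel_weyl (u : Vn) (rho : Mq) :
  conv_channel G (W u) rho = \tr (W (dilate s1 s2 u) *m rho) *: W (dilate t1 t2 u).
Proof.
have [Gu Gn0] := Gpos.
have [h00 h01 h10 h11] : [/\ g00 != 0, g01 != 0, g10 != 0 & g11 != 0].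
  by split; exact: Gn0.
have h2 := two_neq0 d_pr d_odd.
case: u => p q; apply: entP => a a'.
rewrite ent_conv_channel entZ ent_weyl //=.
have [aq|aq] := eqVneq a (a' + t2 *: q); last first.
  rewrite mul0r mulr0 big1 // => b _; rewrite ent_weyl //=.
  rewrite (_ : (_ == _) = false) ?mul0r ?mulr0 //.
  apply/negbTE; apply: contra_neq aq => /rowP e; apply/rowP => k.
  have := e k; rewrite !mxE => ek; apply: (mulfI h01).
  rewrite mulrDr /t2 mulrA divff // mul1r; apply: (addIr (g11 * b 0 k)).
  by rewrite ek; ring.
rewrite mul1r ent_tr mulr_suml.
have b10 : bijective (fun b : Zdn => g00 *: a + g10 *: b).
  exists (fun z => g10^-1 *: (z - g00 *: a)) => b.
    by rewrite addrC addKr scalerA mulVf // scale1r.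
  by rewrite scalerA divff // scale1r addrC subrK.
under [RHS]eq_bigr do rewrite entM mulr_suml.
rewrite [RHS]exchange_big /= [RHS](reindex _ (onW_bij _ b10)) /=.
apply: eq_bigr => b _; set z := g00 *: a + g10 *: b.
rewrite [in RHS](bigD1 (z + s2 *: q)) //= [in RHS]ent_weyl //= eqxx mul1r.
rewrite [X in _ = _ + X]big1 ?addr0; last first.
  by move=> x xn; rewrite ent_weyl //= (negPf xn) !mul0r.
have -> : g00 *: a' + g10 *: b = z + s2 *: q.
  by rewrite /z aq /s2 /t2; apply/rowP => k; rewrite !mxE; field.
rewrite ent_weyl //= (_ : _ == _) ?mul1r; last first.
  by apply/eqP/rowP => k; rewrite aq !mxE /t2; field.
rewrite mulrAC -omega_powD // mulrC; congr (w _ * _).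
rewrite /z !(dotpDr, dotpZl, dotpZr) /s1 /s2 /t1 /t2 conv_detE; field.
by rewrite h01 h10.
Qed.

(* Every character of [M] is [u |-> w (symp v u)] for exactly [d ^ n] vectors [v];
   the projectors are indexed by all [v], with weight [d ^ - n], instead of by the
   characters. *)
Lemma conv_channel_stab (P : Mq) : pure_stabilizer_state P ->
  exists (e psi : Vn -> 'cV[C]_qudits), measure_prepare e psi (conv_channel G P).
Proof.
move=> [_ [M [mu [Miso much PE]]]].
have [Gu Gn0] := Gpos.
have [h00 h01 h10 h11] : [/\ g00 != 0, g01 != 0, g10 != 0 & g11 != 0].
  by split; exact: Gn0.
have s1n : s1 != 0 by rewrite mulf_neq0 ?invr_eq0.
have s2n : s2 != 0 by rewrite oppr_eq0 mulf_neq0 ?invr_eq0.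
have t1n : t1 != 0 by rewrite oppr_eq0 mulf_neq0 ?invr_eq0 // conv_det_neq0.
have t2n : t2 != 0 by rewrite invr_eq0.
(* The opposite phases of measurement and preparation make the coefficients at [u] and [u'] multiply
   to [mu u' * w (symp v (u - u'))], whose sum over [v] selects [u = u']. *)
pose nuE (v u : Vn) := w (symp v u); pose nuF (v u : Vn) := mu u * w (- symp v u).
have wnorm x : `|w x| = 1.
  by apply/eqP; rewrite -sqrp_eq1 // normCK -omega_powN // -omega_powD // subrr.
have nuEch v : is_character M (nuE v).
  by split=> [u u' _ _|u _]; [rewrite /nuE sympDr omega_powD|exact: wnorm].
have nuFch v : is_character M (nuF v).
  have [muM mu1] := much; split=> [u u' uM uM'|u uM].
    by rewrite /nuF muM // sympDr opprD omega_powD // mulrACA.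
  by rewrite normrM wnorm mu1 // mulr1.
have /choice[e eP] v := dilated_stab_op_proj d_pr d_odd Miso (nuEch v) s1n s2n.
have /choice[psi psiP] v := dilated_stab_op_proj d_pr d_odd Miso (nuFch v) t1n t2n.
pose N : R := (d ^ n)%:R.
have N0 : 0 < N by rewrite ltr0n expn_gt0 prime_gt0.
have NC : N%:C = (d ^ n)%:R :> C by rewrite rmorph_nat.
pose c : R := Num.sqrt N^-1.
have cc : c%:C * (c%:C)^* = (d ^ n)%:R^-1.
  rewrite conj_real -rmorphM /= -expr2 sqr_sqrtr ?invr_ge0 ?ltW //.
  by rewrite rmorphV ?unitfE ?gt_eqF //= NC.
have dn0 := dn_neq0 R n d_pr.
exists (fun v => c%:C *: e v), psi; split.
- under eq_bigr do rewrite projZ cc -(eP _).2 /dilated_stab_op scalerA scaler_sumr.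
  rewrite exchange_big (bigD1 (0 : Vn)) ?mem0v //= [X in _ + X]big1 ?addr0 => [|u /andP[_ u0]].
    rewrite dilate0 weyl0 // -scaler_sumr -scaler_suml scalerA sum_symp // eqxx mul1r.
    by rewrite mulrACA mulVf // mulr1 scale1r.
  by rewrite -scaler_sumr -scaler_suml sum_symp // (negPf u0) mul0r scale0r scaler0.
- by move=> v; exact: (psiP v).1.
- move=> rho; rewrite PE /stab_op scaler_sumr; under eq_bigr do rewrite scalerA.
  rewrite conv_channel_sum; set D : C := (d ^ n)%:R in cc dn0 *.
  pose A u := \tr (W (dilate s1 s2 u) *m rho).
  (* The selection of [u = u'] is inserted as a sum over [v], worth [d ^ n * d ^ n]. The three
     factors [D^-1] are the measurement weight and the normalizations of the two stabilizer
     projectors; two of them cancel this value. *)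
  transitivity (\sum_(u' | u' \in M) (D^-1 * D^-1 * D^-1 * mu u' *
      \sum_(u | u \in M) A u * \sum_v w (symp v (u - u'))) *: W (dilate t1 t2 u')).
    apply: eq_bigr => u' uM'; rewrite conv_channel_weyl scalerA -/(A u').
    congr (_ *: _); rewrite (bigD1 u') //= [X in _ + X]big1 ?addr0 => [|u /andP[_ un]].
      by rewrite sum_symp // subrr eqxx mul1r -/D; field.
    by rewrite sum_symp // subr_eq0 (negPf un) mul0r mulr0.
  have EE v : ((c%:C *: e v) ^t* *m rho *m (c%:C *: e v)) 0 0 =
      D^-1 * (D^-1 * \sum_(u | u \in M) w (symp v u) * A u).
    rewrite form_tr projZ cc -(eP v).2 -scalemxAr mxtraceZ mxtrace_mulC.
    rewrite /dilated_stab_op -scalemxAl mxtraceZ mulmx_suml raddf_sum.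
    congr (_ * (_ * _)); apply: eq_bigr => u _.
    by rewrite -scalemxAl /= mxtraceZ.
  under [RHS]eq_bigr do rewrite EE -(psiP _).2 /dilated_stab_op scalerA scaler_sumr.
  rewrite [RHS]exchange_big; apply: eq_bigr => u' _ /=.
  under [RHS]eq_bigr do rewrite scalerA.
  rewrite -scaler_suml; congr (_ *: _).
  under [in LHS]eq_bigr do rewrite mulr_sumr.
  rewrite exchange_big mulr_sumr; apply: eq_bigr => v _.
  rewrite /nuF -/D !mulr_sumr !mulr_suml; apply: eq_bigr => u _.
  by rewrite sympDr sympNr omega_powD //; ring.
Qed.

End ConvolutionChannel.

Lemma conv_channel_measure_prepare (R : realType) (d n : nat) (G : 'M['F_d]_2)
    (sigma : 'M[R[i]]_#|{: 'rV['F_d]_n}|) :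
  prime d -> odd d -> positive_convolution G -> stabilizer_mixture sigma ->
  exists (T : finType) (e psi : T -> 'cV[R[i]]_#|{: 'rV['F_d]_n}|),
    measure_prepare e psi (conv_channel G sigma).
Proof.
move=> d_pr d_odd Gpos [r [p [P [[p0 p1] Pst sigmaE]]]].
have /choice[e] k := conv_channel_stab d_pr d_odd Gpos (Pst k).
move=> /choice[psi mp].
have sigma_mp := mp_mix (f0 := conv_channel G sigma) p0 p1 mp.
do 3!eexists; apply: sigma_mp => X.
by rewrite sigmaE conv_channel_sum.
Qed.

Theorem theorem3 (R : realType) (d n : nat) (G : 'M['F_d]_2)
    (sigma : 'M[R[i]]_#|{: 'rV['F_d]_n}|) :
  prime d -> odd d -> (1 <= n)%N ->
  positive_convolution G ->
  is_state sigma -> stabilizer_mixture sigma ->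
  [/\ entanglement_breaking (conv_channel G sigma),
      forall (a b : nat) (Phi : 'M[R[i]]_a -> 'M[R[i]]_b),
        (0 < a)%N -> is_channel Phi ->
        holevo_chi (tens_map (conv_channel G sigma) Phi) =
        holevo_chi (conv_channel G sigma) + holevo_chi Phi,
      cvgn (holevo_rate (conv_channel G sigma)) &
      holevo_capacity (conv_channel G sigma) =
      holevo_chi (conv_channel G sigma)].
Proof.
move=> d_pr d_odd _ Gpos sigma_st sigma_mix.
have [T [e [psi mp]]] := conv_channel_measure_prepare d_pr d_odd Gpos sigma_mix.
have dim0 := state_dim_gt0 sigma_st.
have rate := holevo_rate_cvg dim0 mp.
split; first exact: mp_entanglement_breaking mp.
- by move=> a b Phi a0 Phi_ch; exact: holevo_chi_tens_mp mp Phi_ch dim0 a0.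
- by apply: cvgP rate.
- exact: cvg_lim rate.
Qed.
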